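(* Let $\mathcal{X}^\star\in\mathbb{R}^{d_1\times\cdots\times d_N}$ be a tensor with TT ranks $\mathbf{r}=(r_1,\dots,r_{N-1})$, $\overline{r}=\max_i r_i$, and let $\{\boldsymbol{X}_i^\star\}_{i=1}^N$ be left-orthogonal form factors of a minimal TT decomposition of $\mathcal{X}^\star$. Assume that the linear map $\mathcal{A}:\mathbb{R}^{d_1\times\cdots\times d_N}\to\mathbb{R}^m$ obeys the $(N+3)\overline{r}$-RIP with a constant $\delta_{(N+3)\overline{r}}\le\frac{4}{15}$. Given $\boldsymbol{y}=\mathcal{A}(\mathcal{X}^\star)$, let $g(\boldsymbol{X}_1,\dots,\boldsymbol{X}_N)=\frac{1}{2m}\|\mathcal{A}([\boldsymbol{X}_1,\dots,\boldsymbol{X}_N])-\boldsymbol{y}\|_2^2$ for factors $\boldsymbol{X}_i\in\mathbb{R}^{r_{i-1}\times d_i\times r_i}$, and let $\{\boldsymbol{X}_i^{(t)}\}_{t\ge0}$ be the iterates generated by the Riemannian gradient descent (RGD) algorithm (defined in the context) applied to $g$ with step size $\mu>0$, started from factors $\{\boldsymbol{X}_i^{(0)}\}$ with $L(\boldsymbol{X}_i^{(0)})^\top L(\boldsymbol{X}_i^{(0)})=\mathbf{I}_{r_i}$ for $i=1,\dots,N-1$. Suppose that $$\operatorname{dist}^2(\{\boldsymbol{X}_i^{(0)}\},\{\boldsymbol{X}_i^\star\})\le\frac{(4-15\delta_{(N+3)\overline{r}})\,\underline{\sigma}^2(\mathcal{X}^\star)}{8\left(N+1+\sum_{i=2}^{N-1}r_i\right)(57N^2+393N-450)}$$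 and that $\mu\le\frac{4-15\delta_{(N+3)\overline{r}}}{10(9N-5)(1+\delta_{(N+3)\overline{r}})^2}$. Then for all $t\ge0$, $$\operatorname{dist}^2(\{\boldsymbol{X}_i^{(t+1)}\},\{\boldsymbol{X}_i^\star\})\le\left(1-\frac{4-15\delta_{(N+3)\overline{r}}}{320\left(N+1+\sum_{i=2}^{N-1}r_i\right)\kappa^2(\mathcal{X}^\star)}\,\mu\right)\operatorname{dist}^2(\{\boldsymbol{X}_i^{(t)}\},\{\boldsymbol{X}_i^\star\}).$$
   Context: Let $N\ge 2$. TT format: for factors $\boldsymbol{X}_i\in\mathbb{R}^{r_{i-1}\times d_i\times r_i}$, $i=1,\dots,N$, with $r_0=r_N=1$, write $\boldsymbol{X}_i(s_i)=\boldsymbol{X}_i(:,s_i,:)\in\mathbb{R}^{r_{i-1}\times r_i}$, and let $[\boldsymbol{X}_1,\dots,\boldsymbol{X}_N]\in\mathbb{R}^{d_1\times\cdots\times d_N}$ be the tensor with entries $\boldsymbol{X}_1(s_1)\boldsymbol{X}_2(s_2)\cdots\boldsymbol{X}_N(s_N)$. The left unfolding $L(\boldsymbol{X}_i)\in\mathbb{R}^{(r_{i-1}d_i)\times r_i}$ stacks $\boldsymbol{X}_i(1),\dots,\boldsymbol{X}_i(d_i)$ vertically; the right unfolding is $R(\boldsymbol{X}_i)=[\boldsymbol{X}_i(1)\ \cdots\ \boldsymbol{X}_i(d_i)]\in\mathbb{R}^{r_{i-1}\times(d_ir_i)}$. A decomposition $\mathcal{X}=[\boldsymbol{X}_1,\dots,\boldsymbol{X}_N]$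 is minimal if $\operatorname{rank}L(\boldsymbol{X}_i)=r_i$ and $\operatorname{rank}R(\boldsymbol{X}_i)=r_{i-1}$ for all $i$; then $(r_1,\dots,r_{N-1})$ are the TT ranks of $\mathcal{X}$. Equivalently, $r_i$ is the rank of the $i$-th unfolding matrix $\mathcal{X}^{\langle i\rangle}\in\mathbb{R}^{(d_1\cdots d_i)\times(d_{i+1}\cdots d_N)}$, whose entry in the row indexed by $(s_1,\dots,s_i)$ and column indexed by $(s_{i+1},\dots,s_N)$ is $\mathcal{X}(s_1,\dots,s_N)$. Factors are in left-orthogonal form if $L(\boldsymbol{X}_i)^\top L(\boldsymbol{X}_i)=\mathbf{I}_{r_i}$ for $i=1,\dots,N-1$ (such minimal decompositions always exist). For a tensor $\mathcal{X}$ with TT ranks $(r_1,\dots,r_{N-1})$: $\underline{\sigma}(\mathcal{X})=\min_{1\le i\le N-1}\sigma_{r_i}(\mathcal{X}^{\langle i\rangle})$, $\overline{\sigma}(\mathcal{X})=\max_{1\le i\le N-1}\sigma_1(\mathcal{X}^{\langle i\rangle})$, $\kappa(\mathcal{X})=\overline{\sigma}(\mathcal{X})/\underline{\sigma}(\mathcal{X})$, where $\sigma_j$ denotes the $j$-th largest singular value. Distance: for orthogonal matrices $\boldsymbol{R}_i\in\mathbb{O}^{r_i\times r_i}$, $i=1,\dots,N-1$, with $\boldsymbol{R}_0=\boldsymbol{R}_N=1$, let $L_{\boldsymbol{R}}(\boldsymbol{X}_i^\star)$ be the vertical stack of $\boldsymbol{R}_{i-1}^\top\boldsymbol{X}_i^\star(s)\boldsymbol{R}_i$,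 $s=1,\dots,d_i$. Then $$\operatorname{dist}^2(\{\boldsymbol{X}_i\},\{\boldsymbol{X}_i^\star\})=\min_{\boldsymbol{R}_i\in\mathbb{O}^{r_i\times r_i},\,i\in[N-1]}\ \sum_{i=1}^{N-1}\overline{\sigma}^2(\mathcal{X}^\star)\|L(\boldsymbol{X}_i)-L_{\boldsymbol{R}}(\boldsymbol{X}_i^\star)\|_F^2+\|L(\boldsymbol{X}_N)-L_{\boldsymbol{R}}(\boldsymbol{X}_N^\star)\|_2^2 .$$ RIP: the linear map $\mathcal{A}$ satisfies the $q$-RIP with constant $\delta_q$ if $(1-\delta_q)\|\mathcal{X}\|_F^2\le\frac1m\|\mathcal{A}(\mathcal{X})\|_2^2\le(1+\delta_q)\|\mathcal{X}\|_F^2$ for all tensors $\mathcal{X}\in\mathbb{R}^{d_1\times\cdots\times d_N}$ all of whose TT ranks are at most $q$. RGD applied to an objective $F(\boldsymbol{X}_1,\dots,\boldsymbol{X}_N)$ with step size $\mu>0$: for each $t\ge 0$, with all gradients evaluated at $(\boldsymbol{X}_1^{(t)},\dots,\boldsymbol{X}_N^{(t)})$, $$L(\boldsymbol{X}_i^{(t+1)})=\operatorname{Retr}\Big(L(\boldsymbol{X}_i^{(t)})-\tfrac{\mu}{\overline{\sigma}^2(\mathcal{X}^\star)}\mathcal{P}_{L(\boldsymbol{X}_i^{(t)})}\big(\nabla_{L(\boldsymbol{X}_i)}F\big)\Big),\ i\in[N-1],\qquad L(\boldsymbol{X}_N^{(t+1)})=L(\boldsymbol{X}_N^{(t)})-\mu\nabla_{L(\boldsymbol{X}_N)}F,$$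 where $\nabla_{L(\boldsymbol{X}_i)}F$ is the Euclidean gradient of $F$ with respect to $L(\boldsymbol{X}_i)$, $\mathcal{P}_{\boldsymbol{Y}}(\boldsymbol{B})=\boldsymbol{B}-\frac12\boldsymbol{Y}(\boldsymbol{B}^\top\boldsymbol{Y}+\boldsymbol{Y}^\top\boldsymbol{B})$ is the projection onto the tangent space of the Stiefel manifold at $\boldsymbol{Y}$, and $\operatorname{Retr}(\widehat{\boldsymbol{Y}})=\widehat{\boldsymbol{Y}}(\widehat{\boldsymbol{Y}}^\top\widehat{\boldsymbol{Y}})^{-1/2}$ is the polar retraction. *)

(* Defs.v *)
From HB Require Import structures.
From mathcomp Require Import all_boot all_order all_algebra.
From mathcomp Require Import polyrcf.
From mathcomp Require Import all_classical all_reals all_analysis.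

Set Implicit Arguments.
Unset Strict Implicit.
Unset Printing Implicit Defensive.

Import Order.TTheory GRing.Theory Num.Theory numFieldNormedType.Exports.

Local Open Scope classical_set_scope.
Local Open Scope ring_scope.

(** ** Matrices *)

(* Squared Frobenius norm; on column vectors, the squared Euclidean norm. *)
Definition frob2 (R : realType) m n (A : 'M[R]_(m, n)) : R :=
  \sum_i \sum_j A i j ^+ 2.

Definition orthogonalmx (R : realType) n (A : 'M[R]_n) : Prop :=
  A^T *m A = 1%:M.

(* The real eigenvalues of [A], repeated according to their multiplicity as
   roots of the characteristic polynomial, in nondecreasing order ([rootsR]
   lists the real roots in increasing order, each of them once). *)
Definition eigenvalues (R : realType) n (A : 'M[R]_n) : seq R :=
  flatten [seq nseq (mup x (char_poly A)) x | x <- rootsR (char_poly A)].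

(* The [j]-th largest singular value, with [j] starting at 1.  [A^T *m A] may
   have more eigenvalues than [minn m n]; the extra ones are zero and last. *)
Definition singular_value (R : realType) m n (A : 'M[R]_(m, n)) (j : nat) : R :=
  [seq Num.sqrt x | x <- rev (eigenvalues (A^T *m A))]`_j.-1.

Definition psdmx (R : realType) n (S : 'M[R]_n) : Prop :=
  S^T = S /\ forall x : 'cV[R]_n, 0 <= (x^T *m S *m x) 0 0.

(* The positive semidefinite square root of a positive semidefinite matrix. *)
Definition sqrtmx (R : realType) n (A : 'M[R]_n) : 'M[R]_n :=
  xget 0 [set S | psdmx S /\ S *m S = A].

Definition polar_retr (R : realType) m n (Y : 'M[R]_(m, n)) : 'M[R]_(m, n) :=
  Y *m invmx (sqrtmx (Y^T *m Y)).

Definition stiefel_proj (R : realType) m n (Y B : 'M[R]_(m, n)) :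
    'M[R]_(m, n) :=
  B - 2^-1 *: (Y *m (B^T *m Y + Y^T *m B)).

Definition gradmx (R : realType) m n (f : 'M[R]_(m, n) -> R)
    (Y : 'M[R]_(m, n)) : 'M[R]_(m, n) :=
  \matrix_(a, b) 'D_(delta_mx a b) f Y.

(** ** Tensors and their unfoldings *)

Notation multi_index d := {dffun forall k, 'I_(d k)}.

(* [R^o] provides the [lmodType R] structure of the space of tensors. *)
Notation tensor R d := {ffun multi_index d -> R^o}.

Definition tnorm2 (R : realType) N (d : 'I_N -> nat) (X : tensor R d) : R :=
  \sum_s (X s : R) ^+ 2.

(* Multi-indices for the first [i] modes and for the remaining ones. *)
Notation row_index d i :=
  {dffun forall k : {k | (nat_of_ord k < i)%N}, 'I_(d (sval k))}.
Notation col_index d i :=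
  {dffun forall k : {k | ~~ (nat_of_ord k < i)%N}, 'I_(d (sval k))}.

Definition merge_index N (d : 'I_N -> nat) i
    (a : row_index d i) (b : col_index d i) : multi_index d :=
  [ffun k : 'I_N => match @boolP (k < i)%N with
             | AltTrue h => a (exist _ k h)
             | AltFalse h => b (exist _ k h)
             end].

(* The [i]-th unfolding matrix; its rows and columns are numbered by the
   enumerations of the two types of multi-indices. *)
Definition unfolding (R : realType) N (d : 'I_N -> nat) (i : nat)
    (X : tensor R d) : 'M[R]_(#|row_index d i|, #|col_index d i|) :=
  \matrix_(a, b) X (merge_index (enum_val a) (enum_val b)).

Definition tt_rank (R : realType) N (d : 'I_N -> nat) (X : tensor R d)
    (i : nat) : nat :=
  \rank (unfolding i X).

(* The extrema range over 1 <= i <= N - 1; for N >= 2 the initial value of the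
   minimum is its own term i = 1, and singular values are nonnegative. *)
Definition sigma_low (R : realType) N (d : 'I_N -> nat) (X : tensor R d) : R :=
  let s i := singular_value (unfolding i X) (tt_rank X i) in
  \big[Num.min/s 1%N]_(1 <= i < N) s i.

Definition sigma_up (R : realType) N (d : 'I_N -> nat) (X : tensor R d) : R :=
  \big[Num.max/0]_(1 <= i < N) singular_value (unfolding i X) 1.

Definition cond_number (R : realType) N (d : 'I_N -> nat) (X : tensor R d) : R :=
  sigma_up X / sigma_low X.

(** ** The tensor-train format *)

(* Factors are numbered from 0: the factor of index [i : 'I_N] is the
   (i+1)-st one, of size [r i] x [d i] x [r i.+1], given by its slices.  Only
   [r 0], ..., [r N] matter; [r 0 = 1] and [r N = 1] are assumed separately. *)
Definition factors (R : realType) N (d : 'I_N -> nat) (r : nat -> nat) : Type :=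
  forall i : 'I_N, 'I_(d i) -> 'M[R]_(r i, r i.+1).

(* The product of the slices selected by [s] in the first [k] factors. *)
Fixpoint tt_prod (R : realType) N (d : 'I_N -> nat) (r : nat -> nat)
    (X : factors R d r) (s : multi_index d) (k : nat) :
    (k <= N)%N -> 'M[R]_(r 0, r k) :=
  match k with
  | 0 => fun _ => 1%:M
  | k'.+1 => fun h =>
      tt_prod X s (ltnW h) *m X (Ordinal h) (s (Ordinal h))
  end.

(* [conform_mx] casts the product from ['M_(r 0, r N)] to ['M_1]; it is only
   meaningful when [r 0 = 1] and [r N = 1]. *)
Definition tt_tensor (R : realType) N (d : 'I_N -> nat) (r : nat -> nat)
    (X : factors R d r) : tensor R d :=
  [ffun s => conform_mx (0 : 'M[R]_1) (tt_prod X s (leqnn N)) 0 0].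

Definition lunfold (R : realType) d p q (Y : 'I_d -> 'M[R]_(p, q)) :
    'M[R]_(\sum_(s < d) p, q) :=
  \mxcol_(s < d) Y s.

Definition runfold (R : realType) d p q (Y : 'I_d -> 'M[R]_(p, q)) :
    'M[R]_(p, \sum_(s < d) q) :=
  \mxrow_(s < d) Y s.

(* The inverse of [lunfold]. *)
Definition lfold (R : realType) d p q (M : 'M[R]_(\sum_(s < d) p, q)) :
    'I_d -> 'M[R]_(p, q) :=
  fun s => submxcol M s.

Definition tt_minimal (R : realType) N (d : 'I_N -> nat) (r : nat -> nat)
    (X : factors R d r) : Prop :=
  forall i : 'I_N,
    \rank (lunfold (X i)) = r i.+1 /\ \rank (runfold (X i)) = r i.

Definition left_orthogonal (R : realType) N (d : 'I_N -> nat) (r : nat -> nat)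
    (X : factors R d r) : Prop :=
  forall i : 'I_N, (i.+1 < N)%N -> (lunfold (X i))^T *m lunfold (X i) = 1%:M.

(* The families R_0, ..., R_N; the entries after [N] are never used. *)
Definition rotations (R : realType) (N : nat) (r : nat -> nat) :
    set (forall k : nat, 'M[R]_(r k)) :=
  [set Q | (forall k, orthogonalmx (Q k)) /\ Q 0%N = 1%:M /\ Q N = 1%:M].

Arguments rotations R N r : clear implicits.

Definition rotate (R : realType) N (d : 'I_N -> nat) (r : nat -> nat)
    (Q : forall k : nat, 'M[R]_(r k)) (X : factors R d r) : factors R d r :=
  fun i s => (Q i)^T *m X i s *m Q i.+1.

Arguments rotate {R N d r} Q X i s.

(* Squared distance.  The minimum (of a continuous function on a compact set)
   is written as an infimum. *)
Definition dist2 (R : realType) N (d : 'I_N -> nat) (r : nat -> nat)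
    (X Xs : factors R d r) : R :=
  inf [set \sum_(i < N | (i.+1 < N)%N)
             sigma_up (tt_tensor Xs) ^+ 2 *
             frob2 (lunfold (X i) - lunfold (rotate Q Xs i))
         + \sum_(i < N | i.+1 == N)
             frob2 (lunfold (X i) - lunfold (rotate Q Xs i))
      | Q in rotations R N r].

(** ** Measurements and Riemannian gradient descent *)

Definition rip (R : realType) N (d : 'I_N -> nat) m
    (A : {linear tensor R d -> 'cV[R]_m}) (q : nat) (delta : R) : Prop :=
  forall X : tensor R d,
    (forall i, (0 < i < N)%N -> (tt_rank X i <= q)%N) ->
    (1 - delta) * tnorm2 X <= m%:R^-1 * frob2 (A X)
    /\ m%:R^-1 * frob2 (A X) <= (1 + delta) * tnorm2 X.

Definition sensing_loss (R : realType) N (d : 'I_N -> nat) (r : nat -> nat) m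
    (A : tensor R d -> 'cV[R]_m) (y : 'cV[R]_m) (X : factors R d r) : R :=
  (2 * m%:R)^-1 * frob2 (A (tt_tensor X) - y).

(* The gradient of [F] at [X] with respect to the left unfolding of the factor
   [i], the other factors being fixed. *)
Definition grad_factor (R : realType) N (d : 'I_N -> nat) (r : nat -> nat)
    (F : factors R d r -> R) (X : factors R d r) (i : 'I_N) :
    'M[R]_(\sum_(s < d i) r i, r i.+1) :=
  gradmx (fun Y : 'M[R]_(\sum_(s < d i) r i, r i.+1) =>
            F (@dfwith 'I_N (fun j => 'I_(d j) -> 'M[R]_(r j, r j.+1))
                 X i (lfold Y)))
         (lunfold (X i)).

Definition rgd_step (R : realType) N (d : 'I_N -> nat) (r : nat -> nat)
    (F : factors R d r -> R) (sigma mu : R) (X : factors R d r) :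
    factors R d r :=
  fun i =>
    let L := lunfold (X i) in
    let G := grad_factor F X i in
    lfold (if (i.+1 < N)%N
           then polar_retr (L - (mu / sigma ^+ 2) *: stiefel_proj L G)
           else L - mu *: G).

Definition rgd (R : realType) N (d : 'I_N -> nat) (r : nat -> nat)
    (F : factors R d r -> R) (sigma mu : R) (X0 : factors R d r) (t : nat) :
    factors R d r :=
  iter t (rgd_step F sigma mu) X0.

(* Main.v *)
Require Import Defs.
From HB Require Import structures.
From mathcomp Require Import all_boot all_order all_algebra.
From mathcomp Require Import polyrcf complex.
From mathcomp Require Import all_classical all_reals all_analysis.
From mathcomp Require Import ring lra zify.

(* One step is analysed against an arbitrary rotation [Z] of the factors of
   [Xstar], with [D] the objective of the distance at that rotation and
   [e = |[X] - [Z]|_F].  The polar retraction does not increase the distance to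
   the Stiefel manifold, so [D] decreases by
   [2 mu \sum_i <X_i - Z_i, P(grad_i)> - mu^2 |grad|^2] (suitably weighted).  The
   tensors [X_1, ..., X_i - Z_i, ..., X_N] add up to [[X] - [Z]] plus terms of
   order [N D / sigma_up], and so does the effect of the tangent projections;
   with the restricted isometry property, the decrease is at least
   [mu (4 - 15 delta) / 40 * e^2].
   Conversely, sequential Davis-Kahan alignment of the left interface matrices
   shows that some rotation has objective at most
   [8 (N + 1 + \sum r_i) kappa^2 e^2]; this bounds the minimum, hence turns the
   decrease into a linear rate. *)

Set Implicit Arguments.
Unset Strict Implicit.
Unset Printing Implicit Defensive.

Import Order.TTheory GRing.Theory Num.Theory numFieldNormedType.Exports.

Local Open Scope classical_set_scope.
Local Open Scope ring_scope.

(** * Frobenius inner product *)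

Section FrobeniusProduct.
Variable R : realType.

(** The corrections in the decrease are of order [N D e / s], whereas the gain is of order [e^2],
    and [D] may exceed [e^2] by a multiple of [S kappa^2], where [S = N + 1 + \sum r_i]. What is
    needed is thus [N D <= c s e]. Two bounds on [D] are available: the radius of the basin,
    proportional to [g^2 / (S q)] with [g = sigma_low] and [q = 57 N^2 + 393 N - 450], and the
    alignment bound, proportional to [S (s / g)^2 e^2]. In their product [S] and [g] cancel and
    leave [(s e)^2 / q], so [q] only has to dominate [N^2]. Alignment therefore serves twice, here
    and for the rate. The distance is an infimum, so each step is run at a rotation that is optimal
    up to a slack, and the slack is removed at the end. Singular values are read off the roots of a
    characteristic polynomial; the spectral theorem turns them into [g |W| <= |W V| <= s |W|] for
    right interfaces [V], the form in which they enter the estimates. *)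

Definition mxdot m n (A B : 'M[R]_(m, n)) : R := \tr (A^T *m B).

Definition fnorm m n (A : 'M[R]_(m, n)) : R := Num.sqrt (frob2 A).

Lemma frob2E m n (A : 'M[R]_(m, n)) : frob2 A = mxdot A A.
Proof.
rewrite /frob2 /mxdot /mxtrace exchange_big /=; apply: eq_bigr => j _.
by rewrite mxE; apply: eq_bigr => i _; rewrite mxE expr2.
Qed.

Lemma mxdotC m n (A B : 'M[R]_(m, n)) : mxdot A B = mxdot B A.
Proof. by rewrite /mxdot -mxtrace_tr trmx_mul trmxK. Qed.

Lemma mxdotDl m n (A B C : 'M[R]_(m, n)) :
  mxdot (A + B) C = mxdot A C + mxdot B C.
Proof. by rewrite /mxdot linearD /= mulmxDl mxtraceD. Qed.

Lemma mxdotDr m n (A B C : 'M[R]_(m, n)) :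
  mxdot A (B + C) = mxdot A B + mxdot A C.
Proof. by rewrite /mxdot mulmxDr mxtraceD. Qed.

Lemma mxdotNl m n (A B : 'M[R]_(m, n)) : mxdot (- A) B = - mxdot A B.
Proof. by rewrite /mxdot linearN /= mulNmx raddfN. Qed.

Lemma mxdotNr m n (A B : 'M[R]_(m, n)) : mxdot A (- B) = - mxdot A B.
Proof. by rewrite mxdotC mxdotNl mxdotC. Qed.

Lemma mxdotBl m n (A B C : 'M[R]_(m, n)) :
  mxdot (A - B) C = mxdot A C - mxdot B C.
Proof. by rewrite mxdotDl mxdotNl. Qed.

Lemma mxdotBr m n (A B C : 'M[R]_(m, n)) :
  mxdot A (B - C) = mxdot A B - mxdot A C.
Proof. by rewrite mxdotDr mxdotNr. Qed.

Lemma mxdotZl m n a (A B : 'M[R]_(m, n)) : mxdot (a *: A) B = a * mxdot A B.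
Proof. by rewrite /mxdot linearZ /= -scalemxAl mxtraceZ. Qed.

Lemma mxdotZr m n a (A B : 'M[R]_(m, n)) : mxdot A (a *: B) = a * mxdot A B.
Proof. by rewrite mxdotC mxdotZl mxdotC. Qed.

Lemma mxdot0l m n (A : 'M[R]_(m, n)) : mxdot 0 A = 0.
Proof. by rewrite /mxdot trmx0 mul0mx mxtrace0. Qed.

Lemma mxdot0r m n (A : 'M[R]_(m, n)) : mxdot A 0 = 0.
Proof. by rewrite mxdotC mxdot0l. Qed.

Lemma mxdot_sumr m n I (r : seq I) (P : pred I) A (B : I -> 'M[R]_(m, n)) :
  mxdot A (\sum_(i <- r | P i) B i) = \sum_(i <- r | P i) mxdot A (B i).
Proof.
by apply: (big_morph (mxdot A)) => [B1 B2|]; rewrite ?mxdotDr ?mxdot0r.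
Qed.

Lemma mxdot_mulmxl m n p (M : 'M[R]_(m, n)) (A : 'M[R]_(n, p)) (B : 'M[R]_(m, p)) :
  mxdot (M *m A) B = mxdot A (M^T *m B).
Proof. by rewrite /mxdot trmx_mul mulmxA. Qed.

Lemma mxdot_mulmxr m n p (M : 'M[R]_(n, p)) (A : 'M[R]_(m, n)) (B : 'M[R]_(m, p)) :
  mxdot (A *m M) B = mxdot A (B *m M^T).
Proof. by rewrite /mxdot trmx_mul -mulmxA mxtrace_mulC mulmxA. Qed.

Lemma mxdot_tr m n (A B : 'M[R]_(m, n)) : mxdot A^T B^T = mxdot A B.
Proof. by rewrite /mxdot trmxK mxtrace_mulC -mxtrace_tr trmx_mul trmxK. Qed.

Lemma frob2_ge0 m n (A : 'M[R]_(m, n)) : 0 <= frob2 A.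
Proof. by do 2!apply: sumr_ge0 => ? _; exact: sqr_ge0. Qed.

Lemma frob2_eq0 m n (A : 'M[R]_(m, n)) : frob2 A = 0 -> A = 0.
Proof.
move/eqP; rewrite /frob2 psumr_eq0; last by move=> ? _; apply: sumr_ge0 => ? _;
  exact: sqr_ge0.
move/allP => A0; apply/matrixP => i j; rewrite mxE; apply/eqP.
have := A0 i (mem_index_enum i); rewrite /= psumr_eq0; last by move=> ? _;
  exact: sqr_ge0.
by move/allP => /(_ j (mem_index_enum j)) /=; rewrite sqrf_eq0.
Qed.

Lemma frob20 m n : frob2 (0 : 'M[R]_(m, n)) = 0.
Proof. by rewrite frob2E mxdot0l. Qed.

Lemma frob2N m n (A : 'M[R]_(m, n)) : frob2 (- A) = frob2 A.
Proof. by rewrite !frob2E mxdotNl mxdotNr opprK. Qed.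

Lemma frob2Z m n a (A : 'M[R]_(m, n)) : frob2 (a *: A) = a ^+ 2 * frob2 A.
Proof. by rewrite !frob2E mxdotZl mxdotZr mulrA expr2. Qed.

Lemma frob2_tr m n (A : 'M[R]_(m, n)) : frob2 A^T = frob2 A.
Proof. by rewrite !frob2E mxdot_tr. Qed.

Lemma frob2D m n (A B : 'M[R]_(m, n)) :
  frob2 (A + B) = frob2 A + 2 * mxdot A B + frob2 B.
Proof. by rewrite !frob2E mxdotDl !mxdotDr (mxdotC B A); ring. Qed.

Lemma frob2B m n (A B : 'M[R]_(m, n)) :
  frob2 (A - B) = frob2 A - 2 * mxdot A B + frob2 B.
Proof. by rewrite frob2D frob2N mxdotNr mulrN. Qed.

Lemma frob2D_le m n (A B : 'M[R]_(m, n)) :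
  frob2 (A + B) <= 2 * (frob2 A + frob2 B).
Proof.
by have := frob2_ge0 (A - B); rewrite frob2B frob2D => ?; lra.
Qed.

Lemma mxdot_cauchy m n (A B : 'M[R]_(m, n)) :
  mxdot A B ^+ 2 <= frob2 A * frob2 B.
Proof.
have [A0|A0] := eqVneq (frob2 A) 0.
  by rewrite (frob2_eq0 A0) frob20 mxdot0l expr0n mul0r.
have Apos : 0 < frob2 A by rewrite lt_def A0 frob2_ge0.
have := frob2_ge0 (frob2 A *: B - mxdot A B *: A).
rewrite frob2B !frob2Z mxdotZl mxdotZr (mxdotC B A) => h.
rewrite -subr_ge0 -(pmulr_rge0 _ Apos).
by apply: le_trans h _; rewrite le_eqVlt; apply/orP; left; apply/eqP; ring.
Qed.

Lemma fnorm_ge0 m n (A : 'M[R]_(m, n)) : 0 <= fnorm A.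
Proof. exact: sqrtr_ge0. Qed.

Lemma sqr_fnorm m n (A : 'M[R]_(m, n)) : fnorm A ^+ 2 = frob2 A.
Proof. by rewrite /fnorm sqr_sqrtr // frob2_ge0. Qed.

Lemma fnorm0 m n : fnorm (0 : 'M[R]_(m, n)) = 0.
Proof. by rewrite /fnorm frob20 sqrtr0. Qed.

Lemma fnorm_le m n p q (A : 'M[R]_(m, n)) (B : 'M[R]_(p, q)) a :
  0 <= a -> frob2 A <= a ^+ 2 * frob2 B -> fnorm A <= a * fnorm B.
Proof.
move=> a0 h; rewrite /fnorm -[a](ger0_norm a0) -sqrtr_sqr -sqrtrM ?sqr_ge0 //.
by rewrite ler_wsqrtr.
Qed.

Lemma fnorm_leE m n (A : 'M[R]_(m, n)) a :
  0 <= a -> (fnorm A <= a) = (frob2 A <= a ^+ 2).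
Proof. by move=> a0; rewrite -sqr_fnorm ler_pXn2r ?nnegrE ?fnorm_ge0. Qed.

Lemma mxdot_le m n (A B : 'M[R]_(m, n)) : `|mxdot A B| <= fnorm A * fnorm B.
Proof.
rewrite -sqrtr_sqr /fnorm -sqrtrM ?frob2_ge0 //.
by rewrite ler_wsqrtr // mxdot_cauchy.
Qed.

Lemma fnormD m n (A B : 'M[R]_(m, n)) : fnorm (A + B) <= fnorm A + fnorm B.
Proof.
rewrite fnorm_leE ?addr_ge0 ?fnorm_ge0 // frob2D sqrrD !sqr_fnorm.
have := le_trans (ler_norm _) (mxdot_le A B) => ?; lra.
Qed.

Lemma frob2_row m n (A : 'M[R]_(m, n)) i : frob2 (row i A) = \sum_j A i j ^+ 2.
Proof. by rewrite /frob2 big_ord1; apply: eq_bigr => j _; rewrite mxE. Qed.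

Lemma frob2_mulmx m n p (A : 'M[R]_(m, n)) (B : 'M[R]_(n, p)) :
  frob2 (A *m B) <= frob2 A * frob2 B.
Proof.
rewrite [frob2 A]/frob2 big_distrl; apply: ler_sum => i _ /=.
rewrite -(frob2_tr B) /frob2 big_distrr /=; apply: ler_sum => j _.
have -> : (A *m B) i j = mxdot (row i A)^T (row j B^T)^T.
  rewrite /mxdot trmxK /mxtrace big_ord1 !mxE; apply: eq_bigr => k _.
  by rewrite !mxE.
apply: le_trans (mxdot_cauchy _ _) _; rewrite !frob2_tr.
by rewrite !frob2_row.
Qed.

Lemma mul_orthomx_frob2 m n p (U : 'M[R]_(m, n)) (W : 'M[R]_(n, p)) :
  U^T *m U = 1%:M -> frob2 (U *m W) = frob2 W.
Proof. by move=> U1; rewrite !frob2E mxdot_mulmxl mulmxA U1 mul1mx. Qed.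

Lemma frob2_orthomx m n (U : 'M[R]_(m, n)) :
  U^T *m U = 1%:M -> frob2 U = n%:R.
Proof. by rewrite frob2E /mxdot => ->; rewrite mxtrace1. Qed.

Lemma frob2_cV n (x : 'cV[R]_n) : (x^T *m x) 0 0 = frob2 x.
Proof. by rewrite frob2E /mxdot /mxtrace big_ord1. Qed.

End FrobeniusProduct.

(** * Spectral theorem for real symmetric matrices *)

Section Spectral.
Variable R : realType.

(** Over [R[i]] the matrix is hermitian, hence unitarily diagonalisable with real diagonal. An entry
    of that diagonal is a root of a characteristic polynomial with real coefficients, so it is an
    eigenvalue over [R] and has a real eigenvector there. *)
Lemma symmetric_eigenvector n (A : 'M[R]_n.+1) : A^T = A ->
  exists a (v : 'rV[R]_n.+1), v *m A = a *: v /\ frob2 v = 1.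
Proof.
move=> Asym; pose f := real_complex R.
have Breal : map_mx f A \is a mxOver Num.real.
  by apply/mxOverP => i j; rewrite mxE; apply/complex_realP; exists (A i j).
have Bherm : map_mx f A \is hermsymmx.
  apply: realsym_hermsym => //; apply/is_hermitianmxP.
  by rewrite expr0 scale1r map_mx_id // map_trmx Asym.
have /hermitian_normalmx/orthomx_spectralP := Bherm.
set P := spectralmx _; set D := spectral_diag _ => AE.
have Punit : P \in unitmx by exact: spectral_unit.
have /mxOverP/(_ 0 0)/complex_realP[a Da] := hermitian_spectral_diag_real Bherm.
have PA : P *m map_mx f A = diag_mx D *m P by rewrite AE !mulmxA mulmxV // mul1mx.
have /eigenvalueP[v vA v0] : eigenvalue A a.
  rewrite eigenvalue_root_char -(fmorph_root f) map_char_poly.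
  rewrite -eigenvalue_root_char; apply/eigenvalueP; exists (row 0 P).
    by rewrite -row_mul PA; apply/rowP => j; rewrite mul_diag_mx !mxE Da.
  apply/eqP => P0; have := congr1 (row 0) (mulmxV Punit).
  rewrite row_mul P0 mul0mx => /rowP/(_ 0); rewrite !mxE eqxx => /esym/eqP.
  by rewrite oner_eq0.
have v2 : 0 < frob2 v.
  by rewrite lt_def frob2_ge0 andbT; apply: contra_neq v0 => /frob2_eq0.
exists a, ((Num.sqrt (frob2 v))^-1 *: v); split.
  by rewrite -scalemxAl vA !scalerA mulrC.
by rewrite frob2Z exprVn sqr_sqrtr ?ltW // mulVf ?gt_eqF.
Qed.

(** The reflection in the hyperplane orthogonal to [u = v - e] exchanges the unit vectors [e] and
    [v]; for [u = 0] the identity does. *)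
Lemma householder n (v : 'rV[R]_n.+1) : frob2 v = 1 ->
  exists Q : 'M[R]_n.+1, Q^T *m Q = 1%:M /\ row 0 Q = v.
Proof.
move=> v1; pose e : 'rV[R]_n.+1 := delta_mx 0 0; pose u := v - e.
have e1 : e *m e^T = 1%:M.
  by rewrite trmx_delta mul_delta_mx; apply/matrixP => i j; rewrite !ord1 !mxE.
have [u0|u0] := eqVneq u 0.
  exists 1%:M; rewrite trmx1 mulmx1; split => //.
  by rewrite rowE mulmx1 -/e; apply/esym/eqP; rewrite -subr_eq0 -/u u0.
pose c := frob2 u; pose h := (v *m e^T) 0 0.
have vv : v *m v^T = 1%:M.
  by rewrite [LHS]mx11_scalar -[v in v *m _]trmxK frob2_cV frob2_tr v1.
have ve : v *m e^T = h%:M by rewrite [LHS]mx11_scalar.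
have ev : e *m v^T = h%:M by rewrite -[LHS]trmxK trmx_mul trmxK ve tr_scalar_mx.
have uu : u *m u^T = c%:M.
  by rewrite [LHS]mx11_scalar -[u in u *m _]trmxK frob2_cV frob2_tr.
have cE : c = 2 - 2 * h.
  have := uu; rewrite /u linearB /= mulmxBl !mulmxBr vv ve ev e1 => /matrixP/(_ 0 0).
  by rewrite !mxE /= !mulr1n => <-; ring.
have c0 : c != 0 by apply: contra_neq u0; exact: frob2_eq0.
have eu : e *m u^T = (- (c / 2))%:M.
  rewrite linearB /= mulmxBr ev e1 cE -raddfB /=; congr (_%:M); lra.
pose Q := 1%:M - (2 / c) *: (u^T *m u).
have Qsym : Q^T = Q by rewrite linearB linearZ /= trmx_mul trmxK trmx1.
exists Q; split.
  rewrite Qsym /Q mulmxBr mulmx1 mulmxBl mul1mx -scalemxAl -scalemxAr.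
  rewrite -(mulmxA u^T) (mulmxA u) uu mul_scalar_mx -scalemxAr !scalerA.
  rewrite -addrA -opprD -scalerBl -scalerDl.
  have -> : 2 / c + (2 / c - 2 / c * (2 / c * c)) = 0 by field.
  by rewrite scale0r subr0.
rewrite rowE -/e /Q mulmxBr mulmx1 -scalemxAr mulmxA eu mul_scalar_mx scalerA.
have -> : 2 / c * - (c / 2) = -1 by field.
by rewrite scaleN1r opprK addrC subrK.
Qed.

(** Deflation: conjugating by an orthogonal matrix whose first row is an eigenvector clears the
    first row off the diagonal, symmetry clears the first column, and the induction hypothesis
    treats the remaining block. *)
Lemma symmetric_spectral n (A : 'M[R]_n) : A^T = A ->
  exists (P : 'M[R]_n) (D : 'rV[R]_n),
    P^T *m P = 1%:M /\ A = P *m diag_mx D *m P^T.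
Proof.
elim: n A => [|n IH] A Asym.
  by exists 1%:M, 0; rewrite [A]flatmx0; split; apply/matrixP => -[].
have [a [v [vA v1]]] := symmetric_eigenvector Asym.
have [Q [Q1 Q0]] := householder v1.
have QQ : Q *m Q^T = 1%:M by apply: mulmx1C.
pose B : 'M[R]_(1 + n) := Q *m A *m Q^T.
have Bsym : B^T = B by rewrite /B !trmx_mul trmxK Asym mulmxA.
have B0 : row 0 B = a *: row 0 (1%:M : 'M[R]_n.+1).
  rewrite /B !row_mul Q0 vA -scalemxAl -Q0 -row_mul QQ //.
have Bur : ursubmx B = 0.
  apply/matrixP => i j; rewrite ord1 !mxE.
  have /rowP/(_ (rshift 1 j)) := B0; rewrite !mxE (_ : lshift n 0 = 0);
    last exact/val_inj.
  by move=> ->; rewrite /= mulr0.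
have Bdl : dlsubmx B = 0 by rewrite -[B]Bsym -trmx_ursub Bur trmx0.
have [P [D [P1 BE]]] := IH (drsubmx B) (etrans (trmx_drsub _) (congr1 _ Bsym)).
pose P' : 'M[R]_(1 + n) := block_mx 1%:M 0 0 P.
have P'1 : P'^T *m P' = 1%:M.
  rewrite /P' tr_block_mx mulmx_block trmx1 !trmx0 !mulmx0 !mul0mx !mulmx1.
  by rewrite !addr0 add0r P1 -scalar_mx_block.
pose D' : 'rV[R]_(1 + n) := row_mx (ulsubmx B) D.
have BE' : B = P' *m diag_mx D' *m P'^T.
  rewrite -[LHS]submxK Bur Bdl BE /P' /D' diag_mx_row tr_block_mx !mulmx_block.
  rewrite trmx1 !trmx0 !mulmx0 !mul0mx !mulmx1 !mul1mx !addr0 !add0r.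
  congr block_mx; rewrite ?mulmx0 ?mul0mx //.
  by apply/matrixP => i j; rewrite !ord1 [RHS]mxE eqxx.
exists (Q^T *m P'), D'; split.
  by rewrite trmx_mul trmxK mulmxA -(mulmxA _ Q) QQ mulmx1.
have -> : A = Q^T *m B *m Q by rewrite /B !mulmxA Q1 mul1mx -mulmxA Q1 mulmx1.
by rewrite BE' trmx_mul trmxK !mulmxA.
Qed.

End Spectral.

(** * Positive semidefinite matrices, polar retraction and Procrustes *)

Section PositiveSemidefinite.
Variable R : realType.

Lemma diag_quadform n (P : 'M[R]_n) (D : 'rV[R]_n) (x : 'cV[R]_n) :
  (x^T *m (P *m diag_mx D *m P^T) *m x) 0 0 =
    \sum_i D 0 i * (P^T *m x) i 0 ^+ 2.
Proof.
have -> : x^T *m (P *m diag_mx D *m P^T) *m x =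
    (P^T *m x)^T *m (diag_mx D *m (P^T *m x)).
  by rewrite trmx_mul trmxK !mulmxA.
rewrite mxE; apply: eq_bigr => i _; rewrite mul_diag_mx [in LHS]mxE.
by rewrite mxE mulrCA -expr2.
Qed.

Lemma psdmx_diag n (P : 'M[R]_n) (D : 'rV[R]_n) :
  (forall i, 0 <= D 0 i) -> psdmx (P *m diag_mx D *m P^T).
Proof.
move=> D0; split; first by rewrite !trmx_mul trmxK tr_diag_mx mulmxA.
move=> x; rewrite diag_quadform; apply: sumr_ge0 => i _.
by rewrite mulr_ge0 ?sqr_ge0.
Qed.

Lemma psdmx_spectral n (S : 'M[R]_n) : psdmx S ->
  exists (P : 'M[R]_n) (D : 'rV[R]_n),
    [/\ P^T *m P = 1%:M, S = P *m diag_mx D *m P^T & forall i, 0 <= D 0 i].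
Proof.
move=> [Ssym S0]; have [P [D [P1 SE]]] := symmetric_spectral Ssym.
exists P, D; split=> // i; have := S0 (P *m delta_mx i 0).
rewrite SE diag_quadform mulmxA P1 mul1mx (bigD1 i) //= big1 => [|j ji].
  by rewrite mxE !eqxx expr1n mulr1 addr0.
by rewrite mxE (negPf ji) expr0n mulr0.
Qed.

Lemma psdmx_gram m n (A : 'M[R]_(m, n)) : psdmx (A^T *m A).
Proof.
split; first by rewrite trmx_mul trmxK.
move=> x; rewrite (_ : _ *m x = (A *m x)^T *m (A *m x)) ?frob2_cV ?frob2_ge0 //.
by rewrite trmx_mul !mulmxA.
Qed.

Lemma sqrtmxP n (A : 'M[R]_n) : psdmx A ->
  psdmx (sqrtmx A) /\ sqrtmx A *m sqrtmx A = A.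
Proof.
move=> /psdmx_spectral[P [D [P1 -> D0]]]; rewrite /sqrtmx.
apply: (@xgetPex _ 0 [set S | psdmx S /\ S *m S = _]).
pose E := \row_i Num.sqrt (D 0 i).
exists (P *m diag_mx E *m P^T); split.
  by apply: psdmx_diag => i; rewrite mxE sqrtr_ge0.
rewrite !mulmxA -(mulmxA _ P^T P) P1 mulmx1 -(mulmxA P) mulmx_diag.
congr (_ *m diag_mx _ *m _); apply/rowP => i.
by rewrite !mxE -expr2 sqr_sqrtr.
Qed.

Lemma psdmx_diag_ge0 n (P : 'M[R]_n) (D : 'rV[R]_n) : P^T *m P = 1%:M ->
  psdmx (P *m diag_mx D *m P^T) -> forall i, 0 <= D 0 i.
Proof.
move=> P1 [_ S0] i; have := S0 (P *m delta_mx i 0).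
rewrite diag_quadform mulmxA P1 mul1mx (bigD1 i) //= big1 => [|j ji].
  by rewrite mxE !eqxx expr1n mulr1 addr0.
by rewrite mxE (negPf ji) expr0n mulr0.
Qed.

Lemma diag_mx_unit n (D : 'rV[R]_n) :
  (forall i, D 0 i != 0) -> diag_mx D \in unitmx.
Proof. by move=> D0; rewrite unitmxE det_diag unitfE; apply/prodf_neq0. Qed.

Lemma orthomx_unit n (P : 'M[R]_n) : P^T *m P = 1%:M -> P \in unitmx.
Proof. by move=> P1; have [] := mulmx1_unit P1. Qed.

(** An eigenbasis of [H] also diagonalises [K], with entries [D_i^2 - 1 >= 0]; as [D_i >= 0], every
    [D_i] is at least 1. *)
Lemma psdmx_sqr_ge1 n (H K : 'M[R]_n) : psdmx H -> psdmx K ->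
  H *m H = 1%:M + K -> psdmx (H - 1%:M) /\ H \in unitmx.
Proof.
move=> /psdmx_spectral[P [D [P1 -> D0]]] Kpsd.
have PP : P *m P^T = 1%:M by apply: mulmx1C.
have E1 : 1%:M = P *m diag_mx (const_mx 1) *m P^T :> 'M[R]_n.
  by rewrite diag_const_mx mulmx1 PP.
rewrite !mulmxA -(mulmxA _ P^T P) P1 mulmx1 -(mulmxA P) mulmx_diag => HH.
have KE : K = P *m diag_mx (\row_i (D 0 i ^+ 2 - 1)) *m P^T.
  rewrite -[LHS](addKr 1%:M) -HH {1}E1 addrC -mulmxBl -mulmxBr -raddfB /=.
  by congr (_ *m diag_mx _ *m _); apply/rowP => i; rewrite !mxE expr2.
have D1 i : 1 <= D 0 i.
  move: Kpsd; rewrite KE => /(psdmx_diag_ge0 P1)/(_ i); rewrite mxE subr_ge0.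
  by rewrite -{1}(expr1n _ 2%N) ler_pXn2r ?nnegrE.
split.
  rewrite {1}E1 -mulmxBl -mulmxBr -raddfB /=; apply: psdmx_diag => i.
  by rewrite !mxE subr_ge0.
rewrite !unitmx_mul unitmx_tr (orthomx_unit P1) andbT /=.
by apply: diag_mx_unit => i; rewrite gt_eqF // (lt_le_trans ltr01).
Qed.

Lemma mxdot_psd_ge0 m n (W : 'M[R]_(m, n)) (K : 'M[R]_n) :
  psdmx K -> 0 <= mxdot W (W *m K).
Proof.
move=> [_ K0]; rewrite /mxdot mxtrace_mulC; apply: sumr_ge0 => i _.
have -> : (W *m K *m W^T) i i = ((row i W)^T^T *m K *m (row i W)^T) 0 0.
  rewrite trmxK -row_mul mxE [RHS]mxE; apply: eq_bigr => k _.
  by rewrite [W^T _ _]mxE [row i (W *m K) _ _]mxE [(row i W)^T _ _]mxE [row i W _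
    _]mxE.
exact: K0.
Qed.

(** Tangency of [X] gives [W^T W = 1 + X^T X] for [W = Y + X], so the square root [H] of [W^T W]
    dominates 1 and [W = U H]. With [K = H - 1], [W - Z = (U - Z) + U K]; as [U] and [Z] are both
    orthonormal, the cross term [2 <U - Z, U K>] equals [<U - Z, (U - Z) K> >= 0]. *)
Lemma polar_retr_le m n (Y X Z : 'M[R]_(m, n)) :
  Y^T *m Y = 1%:M -> Z^T *m Z = 1%:M -> Y^T *m X + X^T *m Y = 0 ->
  let U := polar_retr (Y + X) in
  U^T *m U = 1%:M /\ frob2 (U - Z) <= frob2 (Y + X - Z).
Proof.
move=> Y1 Z1 YX; set W := Y + X.
have WW : W^T *m W = 1%:M + X^T *m X.
  have -> : W^T = Y^T + X^T by rewrite linearD.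
  by rewrite mulmxDl !mulmxDr Y1 addrA -(addrA 1%:M) YX addr0.
rewrite /polar_retr; have := sqrtmxP (psdmx_gram W).
set H := sqrtmx _ => -[Hpsd HH]; have HT : H^T = H by case: Hpsd.
have [Kpsd Hu] := psdmx_sqr_ge1 Hpsd (psdmx_gram X) (etrans HH WW).
set U := W *m invmx H => /=.
have UH : W = U *m H by rewrite mulmxKV.
have U1 : U^T *m U = 1%:M.
  rewrite /U trmx_mul trmx_inv HT !mulmxA -(mulmxA _ W^T) -HH.
  by rewrite !mulmxA mulVmx // mul1mx mulmxV.
split=> //; set K := H - 1%:M in Kpsd; have KT : K^T = K by case: Kpsd.
have -> : W - Z = (U - Z) + U *m K.
  by rewrite UH mulmxBr mulmx1 [RHS]addrC addrA subrK.
rewrite [leRHS]frob2D; have K2 := frob2_ge0 (U *m K).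
have := mxdot_psd_ge0 (U - Z) Kpsd; rewrite mulmxBl mxdotBr !mxdotBl.
have dUU : mxdot U (U *m K) = \tr K by rewrite /mxdot mulmxA U1 mul1mx.
have dZZ : mxdot Z (Z *m K) = \tr K by rewrite /mxdot mulmxA Z1 mul1mx.
have dUZ : mxdot U (Z *m K) = mxdot Z (U *m K).
  by rewrite mxdotC mxdot_mulmxr KT.
by rewrite dUU dZZ dUZ => W0; lra.
Qed.

(* The orthogonal polar factor of a contraction [M] with singular values [c]
   satisfies [<Q, M> = \sum c >= \sum c ^+ 2]. *)
Lemma procrustes n (M : 'M[R]_n) :
  psdmx (1%:M - M^T *m M) -> n%:R - 1 < frob2 M ->
  exists Q : 'M[R]_n, orthogonalmx Q /\ frob2 M <= mxdot Q M.
Proof.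
move=> M1 Mn.
have [P [D [P1 GE D0]]] := psdmx_spectral (psdmx_gram M).
have PP : P *m P^T = 1%:M by apply: mulmx1C.
have frobE : frob2 M = \sum_i D 0 i.
  by rewrite frob2E /mxdot GE mxtrace_mulC mulmxA P1 mul1mx mxtrace_diag.
have D1 i : D 0 i <= 1.
  move: M1; rewrite GE -{1}PP -{1}[P]mulmx1 -diag_const_mx -mulmxBl -mulmxBr.
  by rewrite -raddfB => /(psdmx_diag_ge0 P1)/(_ i); rewrite !mxE subr_ge0.
(* The other [n - 1] eigenvalues add up to at most [n - 1], so the strict lower bound on the trace
   leaves something for this one. Hence [M] is invertible and its polar factor can be written with
   [invmx]. *)
have Dpos i : 0 < D 0 i.
  move: Mn; rewrite frobE (bigD1 i) //= => Mn.
  have : \sum_(j < n | j != i) D 0 j <= n%:R - 1.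
    apply: le_trans (ler_sum _ (fun j _ => D1 j)) _.
    by rewrite sumr_const cardC1 card_ord lerBrDr -mulrSr ler_nat prednK
      ?(ltn_ord i) ?(leq_ltn_trans _ (ltn_ord i)).
  by move=> ?; lra.
have := sqrtmxP (psdmx_gram M); set S := sqrtmx _ => -[Spsd SS].
have ST : S^T = S by case: Spsd.
have Gu : M^T *m M \in unitmx.
  rewrite GE !unitmx_mul unitmx_tr (orthomx_unit P1) andbT /=.
  by apply: diag_mx_unit => i; rewrite gt_eqF.
have Su : S \in unitmx by move: Gu; rewrite -SS unitmx_mul => /andP[].
exists (M *m invmx S); split.
  rewrite /orthogonalmx trmx_mul trmx_inv ST !mulmxA -(mulmxA _ M^T) -SS.
  by rewrite !mulmxA mulVmx // mul1mx mulmxV.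
have -> : mxdot (M *m invmx S) M = \tr S.
  by rewrite /mxdot trmx_mul trmx_inv ST -mulmxA -SS mulmxA mulVmx // mul1mx.
rewrite frob2E /mxdot -SS; have [Q [E [Q1 SE E0]]] := psdmx_spectral Spsd.
have QQ : Q *m Q^T = 1%:M by apply: mulmx1C.
have SSE : S *m S = Q *m diag_mx (\row_i (E 0 i ^+ 2)) *m Q^T.
  rewrite SE !mulmxA -(mulmxA _ Q^T Q) Q1 mulmx1 -(mulmxA Q) mulmx_diag.
  by congr (_ *m diag_mx _ *m _); apply/rowP => i; rewrite !mxE expr2.
have E1 i : E 0 i ^+ 2 <= 1.
  move: M1; rewrite -SS SSE -{1}QQ -{1}[Q]mulmx1 -diag_const_mx -mulmxBl -mulmxBr.
  by rewrite -raddfB => /(psdmx_diag_ge0 Q1)/(_ i); rewrite !mxE subr_ge0.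
rewrite SSE SE !(mxtrace_mulC _ Q^T) !mulmxA Q1 !mul1mx !mxtrace_diag.
apply: ler_sum => i _; rewrite mxE expr2.
by rewrite ler_piMr // -(@ler_pXn2r _ 2%N) ?nnegrE // expr1n.
Qed.

End PositiveSemidefinite.

(** * Singular values *)

Section SingularValues.
Variable R : realType.

Lemma sorted_ge_nth (s : seq R) i j :
  sorted >=%R s -> (i <= j)%N -> (j < size s)%N -> s`_j <= s`_i.
Proof.
move=> ss ij js.
have tr : transitive (>=%R : rel R) by move=> x y z xy yz; apply: le_trans yz xy.
have := @sorted_leq_nth _ _ tr (@lexx _ R) 0 s ss i j.
by rewrite !inE; apply => //; exact: leq_ltn_trans js.
Qed.

(** The positive entries of a nonincreasing list form a prefix; beyond its end [nth] returns the
    default 0, in agreement with the count. *)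
Lemma sorted_ge_count_gt0 (s : seq R) i : sorted >=%R s ->
  (0 < s`_i) = (i < count (fun x => 0%R < x)%R s)%N.
Proof.
elim: s i => [|x s IH] i ss /=; first by rewrite nth_nil ltxx.
have s'_sorted := path_sorted ss; have [x0|x0] := ltP 0 x.
  by case: i => [|i] //=; rewrite IH.
have c0 : count (fun x => 0%R < x)%R s = 0%N.
  apply/eqP; rewrite -leqn0 leqNgt -has_count; apply/hasPn => y ys.
  rewrite -leNgt; apply: le_trans x0.
  by move: ss; rewrite /= path_sortedE; [case/andP => /allP/(_ y ys) | move=> a b
    c /= ba cb; exact: le_trans cb ba].
rewrite c0 ltn0; case: i => [|i] /=; first by apply/negbTE; rewrite -leNgt.
by rewrite IH // c0 ltn0.
Qed.

Lemma char_poly_orthomx n (P : 'M[R]_n) (D : 'rV[R]_n) : P^T *m P = 1%:M ->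
  char_poly (P *m diag_mx D *m P^T) = \prod_i ('X - (D 0 i)%:P).
Proof.
move=> P1; have PP : P *m P^T = 1%:M by apply: mulmx1C.
pose f := map_mx (@polyC R).
have fPP : f n n P *m f n n P^T = 1%:M by rewrite -map_mxM PP map_mx1.
have E : char_poly_mx (P *m diag_mx D *m P^T) =
    f n n P *m char_poly_mx (diag_mx D) *m f n n P^T.
  rewrite /char_poly_mx mulmxBr mulmxBl !map_mxM; congr (_ - _).
  by rewrite mul_mx_scalar -scalemxAl fPP scalemx1.
rewrite /char_poly E !det_mulmx mulrAC -det_mulmx fPP det1 mul1r.
rewrite -/(char_poly _) char_poly_trig ?diag_mx_is_trig //.
by apply: eq_bigr => i _; rewrite mxE eqxx mulr1n.
Qed.

Lemma mup_prod_XsubC (I : Type) (r : seq I) (F : I -> R) x :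
  mup x (\prod_(i <- r) ('X - (F i)%:P)) = count_mem x (map F r).
Proof.
elim: r => [|i r IH]; first by rewrite big_nil /= mupNroot ?root1.
rewrite big_cons mupM ?polyXsubC_eq0 ?IH //=.
  by rewrite -['X - _]expr1 mup_XsubCX; case: eqP.
by rewrite monic_neq0 ?monic_prod_XsubC.
Qed.

Lemma count_flatten_nseq (s : seq R) (f : R -> nat) x : uniq s ->
  count_mem x (flatten [seq nseq (f y) y | y <- s]) = ((x \in s) * f x)%N.
Proof.
elim: s => //= y s IH /andP[ys us]; rewrite count_cat IH // count_nseq /= in_cons.
have [->|xy] := eqVneq x y; first by rewrite (negPf ys) ?eqxx /= addn0.
by rewrite ?(eq_sym y) ?(negPf xy).
Qed.

(** In both lists [x] occurs as often as its multiplicity as a root of the characteristic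
    polynomial. This is the bridge from the root-based [eigenvalues] to an orthogonal
    diagonalisation. *)
Lemma eigenvalues_orthomx n (P : 'M[R]_n) (D : 'rV[R]_n) : P^T *m P = 1%:M ->
  perm_eq (eigenvalues (P *m diag_mx D *m P^T)) [seq D 0 i | i <- enum 'I_n].
Proof.
move=> P1; apply/allP => x _ /=; apply/eqP.
have p0 : char_poly (P *m diag_mx D *m P^T) != 0.
  by rewrite monic_neq0 ?char_poly_monic.
rewrite count_flatten_nseq ?uniq_roots //.
have -> : (x \in rootsR (char_poly (P *m diag_mx D *m P^T))) =
    root (char_poly (P *m diag_mx D *m P^T)) x.
  by rewrite -(roots_on_rootsR p0) in_itv.
rewrite -(mup_prod_XsubC (enum 'I_n) (fun i => D 0 i)) big_enum /=.
rewrite -(char_poly_orthomx D P1); case: (boolP (root _ x)) => rx; rewrite ?mul1n //.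
by rewrite mupNroot.
Qed.

Lemma sorted_flatten_nseq (s : seq R) (f : R -> nat) : sorted <%R s ->
  sorted <=%R (flatten [seq nseq (f y) y | y <- s]).
Proof.
rewrite sorted_pairwise; last exact: lt_trans.
rewrite sorted_pairwise; last exact: le_trans.
elim: s => //= x s IH /andP[xs /IH {}IH]; rewrite pairwise_cat IH andbT.
apply/andP; split.
  apply/allrelP => y z; rewrite mem_nseq => /andP[_ /eqP->].
  move=> /flattenP[t /mapP[u us ->]]; rewrite mem_nseq => /andP[_ /eqP->].
  by apply: ltW; apply: (allP xs).
elim: (f x) => //= k ->; rewrite andbT; apply/allP => y.
by rewrite mem_nseq => /andP[_ /eqP->].
Qed.

Lemma sorted_eigenvalues n (B : 'M[R]_n) : sorted >=%R (rev (eigenvalues B)).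
Proof. by rewrite rev_sorted; apply/sorted_flatten_nseq/sorted_roots. Qed.

Lemma rank_diag n (D : 'rV[R]_n) : \rank (diag_mx D) = (\sum_i (D 0 i != 0)%R)%N.
Proof.
elim: n D => [|n IH] D; first by rewrite big_ord0 [diag_mx D]flatmx0 mxrank0.
pose a : 'rV[R]_1 := @lsubmx _ 1 1 n D; pose E : 'rV[R]_n := @rsubmx _ 1 1 n D.
have DE : D = row_mx a E by rewrite hsubmxK.
have -> : \rank (diag_mx D) = \rank (block_mx (diag_mx a) 0 0 (diag_mx E)).
  by rewrite -diag_mx_row -DE.
rewrite rank_diag_block_mx IH big_ord_recl; congr (_ + _)%N; last first.
  by apply: eq_bigr => i _; rewrite mxE; congr (D 0 _ != 0 : nat); apply: val_inj.
have -> : diag_mx a = (D 0 0)%:M.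
  rewrite [LHS]mx11_scalar !mxE /= mulr1n; congr (D 0 _)%:M; exact: val_inj.
have [->|a0] := eqVneq (D 0 0) 0; first by rewrite raddf0 mxrank0.
by rewrite -scalemx1 mxrank_scale_nz // mxrank1.
Qed.

(** A vector [u = w A^T] with [u A = 0] satisfies [|u|^2 = u A w^T = 0], so multiplying [A^T] by [A]
    loses no rank. *)
Lemma rank_gram m n (A : 'M[R]_(m, n)) : \rank (A^T *m A) = \rank A.
Proof.
rewrite -[RHS]mxrank_tr -(mxrank_mul_ker A^T A).
suff -> : (A^T :&: kermx A)%MS = 0 by rewrite mxrank0 addn0.
apply/eqP; rewrite -submx0; apply/rV_subP => u; rewrite sub_capmx.
case/andP => /submxP[w uE] /sub_kermxP uA; rewrite submx0; apply/eqP.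
apply: frob2_eq0; rewrite -frob2_tr -frob2_cV trmxK.
by rewrite {2}uE trmx_mul trmxK mulmxA uA mul0mx mxE.
Qed.

Lemma frob2_mul_gram m n p (A : 'M[R]_(m, n)) (P : 'M[R]_n) D (Z : 'M[R]_(n, p)) :
  A^T *m A = P *m diag_mx D *m P^T ->
  frob2 (A *m Z) = \sum_i D 0 i * frob2 (row i (P^T *m Z)).
Proof.
move=> AE; rewrite frob2E mxdot_mulmxl mulmxA AE -!mulmxA -{1}[P]trmxK.
rewrite -mxdot_mulmxl mul_diag_mx /mxdot /mxtrace.
under [RHS]eq_bigr do rewrite frob2_row mulr_sumr.
rewrite exchange_big; apply: eq_bigr => j _ /=; rewrite mxE.
by apply: eq_bigr => i _; rewrite [_^T _ _]mxE [in X in _ * X]mxE mulrCA expr2.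
Qed.

Lemma frob2_rows m n (A : 'M[R]_(m, n)) : frob2 A = \sum_i frob2 (row i A).
Proof. by under eq_bigr do rewrite frob2_row. Qed.

(** In an eigenbasis of the Gram matrix, [|A Z|^2] is a sum of row norms weighted by eigenvalues,
    each of which is at most the head of the decreasing list. *)
Lemma singular_value1_ge m n (A : 'M[R]_(m, n)) p (Z : 'M[R]_(n, p)) :
  frob2 (A *m Z) <= singular_value A 1 ^+ 2 * frob2 Z.
Proof.
have [P [D [P1 AE D0]]] := psdmx_spectral (psdmx_gram A).
have PP : P *m P^T = 1%:M by apply: mulmx1C.
rewrite (frob2_mul_gram _ AE) -(@mul_orthomx_frob2 _ _ _ _ P^T) ?trmxK //.
rewrite [in leRHS]frob2_rows mulr_sumr; apply: ler_sum => i _.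
apply: ler_wpM2r; first exact: frob2_ge0.
have Di : D 0 i \in rev (eigenvalues (A^T *m A)).
  by rewrite mem_rev AE (perm_mem (eigenvalues_orthomx D P1)) map_f ?mem_enum.
have ss := sorted_eigenvalues (A^T *m A).
have si := Di; rewrite -index_mem in si.
have le1 : D 0 i <= (rev (eigenvalues (A^T *m A)))`_0.
  by rewrite -[X in X <= _](nth_index 0 Di) sorted_ge_nth.
rewrite /singular_value (nth_map 0) ?(leq_ltn_trans _ si) //.
by rewrite sqr_sqrtr // (le_trans (D0 i)).
Qed.

Lemma count_eigenvalues_gt0 m n (A : 'M[R]_(m, n)) :
  count (fun x => 0 < x) (rev (eigenvalues (A^T *m A))) = \rank A.
Proof.
have [P [D [P1 AE D0]]] := psdmx_spectral (psdmx_gram A).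
rewrite count_rev -(rank_gram A) AE.
have Pu := orthomx_unit P1.
rewrite mxrankMfree; last by rewrite row_free_unit unitmx_tr.
rewrite -mxrank_tr trmx_mul mxrankMfree; last by rewrite row_free_unit unitmx_tr.
rewrite mxrank_tr rank_diag (permP (eigenvalues_orthomx D P1)) count_map.
rewrite -sum1_count big_enum_cond /= big_mkcond /=.
by apply: eq_bigr => i _; rewrite lt_def D0 andbT; case: eqP.
Qed.

(** Exactly [\rank A] entries of the decreasing list are positive, so the entry at position
    [\rank A] is the last positive one, that is, the smallest. *)
Lemma singular_value_rank m n (A : 'M[R]_(m, n)) : (0 < \rank A)%N ->
  0 < singular_value A (\rank A) /\
  forall x, x \in eigenvalues (A^T *m A) -> 0 < x ->
    singular_value A (\rank A) ^+ 2 <= x.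
Proof.
move=> r0; set s := rev (eigenvalues (A^T *m A)).
have ss : sorted >=%R s := sorted_eigenvalues _.
have rs : ((\rank A).-1 < count (fun x => 0%R < x)%R s)%N.
  by rewrite count_eigenvalues_gt0 prednK.
have srank : ((\rank A).-1 < size s)%N := leq_trans rs (count_size _ _).
have spos : 0 < s`_(\rank A).-1 by rewrite sorted_ge_count_gt0.
rewrite /singular_value (nth_map 0) // sqrtr_gt0 sqr_sqrtr ?ltW //.
split=> // x; rewrite -mem_rev -/s => xs x0.
have xi := xs; rewrite -index_mem in xi.
move: x0; rewrite -[x](nth_index 0 xs) => x0.
apply: sorted_ge_nth => //; move: x0.
by rewrite sorted_ge_count_gt0 // count_eigenvalues_gt0 => ?; rewrite -ltnS prednK.
Qed.

(** * Singular values of a product [U V] with [U] orthonormal, as bounds for multiplication by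
    [V] *)

Section LeftOrthogonalFactorization.
Variables (m r n : nat) (U : 'M[R]_(m, r)) (V : 'M[R]_(r, n)).
Hypothesis U1 : U^T *m U = 1%:M.

(** [singular_value1_ge] controls factors on the right of [U V] only. Writing [|W V|^2] as the
    pairing of [U W^T] with [U V (W V)^T] and applying Cauchy-Schwarz moves the bound to the left
    side, after one factor [|W V|^2] is cancelled. *)
Lemma frob2_mul_singular_value1 p (W : 'M[R]_(p, r)) :
  frob2 (W *m V) <= singular_value (U *m V) 1 ^+ 2 * frob2 W.
Proof.
set s := singular_value _ _.
have E : frob2 (W *m V) = mxdot (U *m W^T) (U *m V *m (W *m V)^T).
  rewrite [RHS]mxdot_mulmxl !mulmxA U1 mul1mx -mxdot_tr trmxK frob2E.
  by rewrite mxdot_mulmxr !trmx_mul !trmxK.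
have h : frob2 (W *m V) ^+ 2 <= frob2 W * (s ^+ 2 * frob2 (W *m V)).
  rewrite {1}E; apply: le_trans (mxdot_cauchy _ _) _.
  rewrite mul_orthomx_frob2 // frob2_tr ler_wpM2l ?frob2_ge0 //.
  by rewrite -(frob2_tr (W *m V)) singular_value1_ge.
have [->|WV] := eqVneq (frob2 (W *m V)) 0.
  by rewrite mulr_ge0 ?sqr_ge0 ?frob2_ge0.
have WV0 : 0 < frob2 (W *m V) by rewrite lt_def WV frob2_ge0.
by rewrite -(ler_pM2r WV0) -expr2 mulrAC mulrC.
Qed.

(** The lower bound is governed by the eigenvalues of [V V^T]. For an eigenvector [q] of it, [V^T q]
    is nonzero because [V] has independent rows, and it is an eigenvector of [V^T V], the Gram
    matrix of [U V], for the same eigenvalue. That eigenvalue is positive, hence at least the square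
    of the last positive singular value. *)
Lemma frob2_mul_singular_value_rank p (W : 'M[R]_(p, r)) : (0 < r)%N ->
  \rank (U *m V) = r ->
  0 < singular_value (U *m V) r /\
  singular_value (U *m V) r ^+ 2 * frob2 W <= frob2 (W *m V).
Proof.
move=> r0 rk; have [] := @singular_value_rank _ _ (U *m V); rewrite rk // => s0 sle.
split=> //; set s := singular_value _ _ in s0 sle *.
have GE : (U *m V)^T *m (U *m V) = V^T *m V.
  by rewrite trmx_mul -mulmxA (mulmxA U^T) U1 mul1mx.
have [P [D [P1 AE D0]]] := psdmx_spectral (psdmx_gram (U *m V)).
have [Q [E [Q1 VE E0]]] := psdmx_spectral (psdmx_gram V^T).
have QQ : Q *m Q^T = 1%:M by apply: mulmx1C.
have PP : P *m P^T = 1%:M by apply: mulmx1C.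
have Vfree : row_free V.
  by rewrite /row_free eqn_leq rank_leq_row -{1}rk mxrankM_maxr.
rewrite -frob2_tr -[leRHS]frob2_tr trmx_mul (frob2_mul_gram _ VE).
rewrite -(@mul_orthomx_frob2 _ _ _ _ Q^T) ?trmxK // frob2_rows mulr_sumr.
apply: ler_sum => i _; apply: ler_wpM2r; first exact: frob2_ge0.
pose q := col i Q; pose v := V^T *m q.
have q0 : q != 0.
  apply/eqP => q0; have := congr1 (fun A : 'M[R]_r => A i i) Q1.
  rewrite !mxE eqxx big1 => [/esym/eqP|k _]; first by rewrite oner_eq0.
  by have /colP/(_ k) := q0; rewrite !mxE => ->; rewrite mulr0.
have v0 : v != 0.
  apply: contra_neq q0 => v0; apply: trmx_inj; apply: (row_free_inj Vfree).
  have -> : q^T *m V = v^T by rewrite /v trmx_mul trmxK.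
  by rewrite v0 !trmx0 mul0mx.
have Vq : V *m v = E 0 i *: q.
  rewrite /v mulmxA -{1}[V]trmxK VE -!mulmxA.
  have -> : Q^T *m q = delta_mx i 0 by rewrite /q colE mulmxA Q1 mul1mx.
  have -> : diag_mx E *m delta_mx i 0 = E 0 i *: delta_mx i (0 : 'I_1).
    apply/colP => k; rewrite mul_diag_mx !mxE.
    by have [->|] := eqVneq k i; rewrite ?mulr0.
  by rewrite -scalemxAr /q colE.
have Ei : 0 < E 0 i.
  rewrite lt_def E0 andbT; apply: contra_neq v0 => Ei0; apply: frob2_eq0.
  by rewrite frob2E /v mxdot_mulmxl trmxK Vq Ei0 scale0r mxdot0r.
apply: sle => //; rewrite AE (perm_mem (eigenvalues_orthomx D P1)).
have Dv : diag_mx D *m (P^T *m v) = E 0 i *: (P^T *m v).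
  rewrite mulmxA -[diag_mx D]mul1mx -P1 -[P^T *m P *m _]mulmxA -(mulmxA P^T) -AE GE.
  by rewrite -!mulmxA Vq -!scalemxAr.
have /eqP/matrix0Pn[j [k yjk]] : P^T *m v <> 0.
  move=> y0; move/eqP: v0; apply.
  by rewrite -[v]mul1mx -PP -mulmxA y0 mulmx0.
suff -> : E 0 i = D 0 j by rewrite map_f ?mem_enum.
by apply: (mulIf yjk); have := congr1 (fun A : 'M[R]_(n, 1) => A j k) Dv;
  rewrite mul_diag_mx !mxE => ->.
Qed.

End LeftOrthogonalFactorization.
End SingularValues.

(** * Multi-indices and unfoldings *)

(** The matches on [boolP] in [merge_index], [lface] and [rface_rec] have branches that depend on
    the proof. Irrelevance of boolean proofs lets the branch be taken at any given proof. *)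
Lemma boolP_true (b : bool) T (f : b -> T) (g : ~~ b -> T) (h : b) :
  match @boolP b with AltTrue h => f h | AltFalse h => g h end = f h.
Proof.
exact: (match @boolP b as z in alt_spec _ _ _
  return (match z with AltTrue h => f h | AltFalse h => g h end = f h) with
  | AltTrue h' => congr1 f (bool_irrelevance h' h)
  | AltFalse h' => False_ind _ (negP h' h) end).
Qed.

Lemma boolP_false (b : bool) T (f : b -> T) (g : ~~ b -> T) (h : ~~ b) :
  match @boolP b with AltTrue h => f h | AltFalse h => g h end = g h.
Proof.
exact: (match @boolP b as z in alt_spec _ _ _
  return (match z with AltTrue h => f h | AltFalse h => g h end = g h) with
  | AltTrue h' => False_ind _ (negP h h')
  | AltFalse h' => congr1 g (bool_irrelevance h' h) end).
Qed.

Section PartialIndices.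
Variables (N : nat) (d : 'I_N -> nat).

Notation partial_index p := {dffun forall k : {k : 'I_N | p k}, 'I_(d (sval k))}.

Definition restrict_index (p p' : pred 'I_N) (pp' : forall k, p k -> p' k)
    (a : partial_index p') : partial_index p :=
  [ffun k => a (exist _ (sval k) (pp' _ (svalP k)))].

(* [s0] only serves to extend partial indices to total ones. *)
Lemma sum_partial_index (R : nmodType) (s0 : multi_index d)
    (p p' : pred 'I_N) (pp' : forall k, p k -> p' k) (i : 'I_N) (p'i : p' i)
    (F : partial_index p -> 'I_(d i) -> R) :
  ~~ p i -> (forall k, p' k -> k != i -> p k) ->
  \sum_(a : partial_index p') F (restrict_index pp' a) (a (exist _ i p'i)) =
  \sum_(a : partial_index p) \sum_x F a x.
Proof.
move=> pi p'p; rewrite pair_bigA /=.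
pose ext (a : partial_index p) (k : 'I_N) : 'I_(d k) :=
  if @boolP (p k) is AltTrue h then a (exist _ k h) else s0 k.
pose g (ax : partial_index p * 'I_(d i)) : partial_index p' :=
  [ffun k : {k | p' k} => @dfwith 'I_N (fun k => 'I_(d k)) (ext ax.1) i ax.2
    (sval k)].
pose f (a : partial_index p') := (restrict_index pp' a, a (exist _ i p'i)).
have fK : cancel f g.
  move=> a; apply/ffunP => -[k p'k]; rewrite ffunE /=.
  have [ki|ki] := eqVneq k i.
    by subst k; rewrite dfwithin (bool_irrelevance p'i p'k).
  rewrite dfwithout 1?eq_sym // /ext (boolP_true _ _ (p'p _ p'k ki)) ffunE /=.
  by rewrite (bool_irrelevance (pp' _ _) p'k).
have gK : cancel g f.
  move=> [a x]; congr pair; last by rewrite ffunE /= dfwithin.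
  apply/ffunP => -[k pk]; rewrite !ffunE /= dfwithout.
    by rewrite /ext boolP_true.
  by apply: contraNneq pi => ->.
by rewrite [RHS](reindex f) //; apply: onW_bij; exists g.
Qed.

Definition row_part k (s : multi_index d) : row_index d k :=
  [ffun j : {j : 'I_N | (j < k)%N} => s (sval j)].

Definition col_part k (s : multi_index d) : col_index d k :=
  [ffun j : {j : 'I_N | ~~ (j < k)%N} => s (sval j)].

Lemma merge_parts k s : merge_index (row_part k s) (col_part k s) = s.
Proof.
apply/ffunP => j; rewrite ffunE; have /orP[h|h] := orbN (j < k)%N.
  by rewrite (boolP_true _ _ h) ffunE.
by rewrite (boolP_false _ _ h) ffunE.
Qed.

Lemma row_part_merge k (a : row_index d k) (b : col_index d k) :
  row_part k (merge_index a b) = a.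
Proof.
by apply/ffunP => -[j h]; rewrite !ffunE /= (boolP_true _ _ h).
Qed.

Lemma col_part_merge k (a : row_index d k) (b : col_index d k) :
  col_part k (merge_index a b) = b.
Proof.
by apply/ffunP => -[j h]; rewrite !ffunE /= (boolP_false _ _ h).
Qed.

Lemma sum_merge (R : nmodType) k (F : row_index d k -> col_index d k -> R) :
  \sum_(s : multi_index d) F (row_part k s) (col_part k s) =
  \sum_a \sum_b F a b.
Proof.
rewrite pair_bigA /= [RHS](reindex (fun s => (row_part k s, col_part k s))) //.
apply: onW_bij; exists (fun ab => merge_index ab.1 ab.2) => [s|[a b]] /=.
  exact: merge_parts.
by rewrite row_part_merge col_part_merge.
Qed.

Definition row_head (i : 'I_N) (a : row_index d i.+1) : row_index d i :=
  restrict_index (fun k (h : (k < i)%N) => leqW h) a.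

Definition row_last (i : 'I_N) (a : row_index d i.+1) : 'I_(d i) :=
  a (exist _ i (ltnSn i)).

Lemma col_tail_subproof (i k : 'I_N) : ~~ (k < i.+1)%N -> ~~ (k < i)%N.
Proof. by apply: contra => /leqW. Qed.

Lemma col_head_subproof (i : 'I_N) : ~~ (i < i)%N.
Proof. by rewrite ltnn. Qed.

Definition col_tail (i : 'I_N) (b : col_index d i) : col_index d i.+1 :=
  restrict_index (@col_tail_subproof i) b.

Definition col_head (i : 'I_N) (b : col_index d i) : 'I_(d i) :=
  b (exist _ i (col_head_subproof i)).

Lemma row_head_part (i : 'I_N) s : row_head (row_part i.+1 s) = row_part i s.
Proof. by apply/ffunP => j; rewrite !ffunE. Qed.

Lemma row_last_part (i : 'I_N) s : row_last (row_part i.+1 s) = s i.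
Proof. by rewrite /row_last ffunE. Qed.

Lemma col_tail_part (i : 'I_N) s : col_tail (col_part i s) = col_part i.+1 s.
Proof. by apply/ffunP => j; rewrite !ffunE. Qed.

Lemma col_head_part (i : 'I_N) s : col_head (col_part i s) = s i.
Proof. by rewrite /col_head ffunE. Qed.

Lemma sum_row_index (R : nmodType) (s0 : multi_index d) (i : 'I_N)
    (F : row_index d i -> 'I_(d i) -> R) :
  \sum_(a : row_index d i.+1) F (row_head a) (row_last a) = \sum_a \sum_x F a x.
Proof.
apply: sum_partial_index => //=; first by rewrite ltnn.
by move=> k; rewrite ltnS leq_eqVlt => /orP[/eqP/val_inj->|//]; rewrite eqxx.
Qed.

Lemma sum_col_index (R : nmodType) (s0 : multi_index d) (i : 'I_N)
    (F : 'I_(d i) -> col_index d i.+1 -> R) :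
  \sum_(b : col_index d i) F (col_head b) (col_tail b) = \sum_x \sum_b F x b.
Proof.
rewrite exchange_big -(sum_partial_index s0 (@col_tail_subproof i)
  (col_head_subproof i) (fun b x => F x b)) //=; first by rewrite ltnSn.
by move=> k; rewrite -!leqNgt ltn_neqAle eq_sym => -> ->.
Qed.

Lemma sum_enum_val (R : nmodType) (T : finType) (F : T -> R) :
  \sum_(a : 'I_#|T|) F (enum_val a) = \sum_t F t.
Proof. by rewrite [RHS](reindex (@enum_val T predT)) //;
  apply/onW_bij/enum_val_bij. Qed.

Lemma card_row0 (s0 : multi_index d) : #|row_index d 0| = 1%N.
Proof. 
rewrite -(card1 (row_part 0 s0)); apply: eq_card => a.
by rewrite !inE; apply/esym/eqP/ffunP => -[].
Qed.

Lemma card_colN (s0 : multi_index d) : #|col_index d N| = 1%N.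
Proof.
rewrite -(card1 (col_part N s0)); apply: eq_card => b; rewrite !inE;
  apply/esym/eqP/ffunP.
by case=> k h; have := h; rewrite ltn_ord.
Qed.

End PartialIndices.

Section Unfolding.
Variables (R : realType) (N : nat) (d : 'I_N -> nat).
Implicit Types T : tensor R d.

Lemma unfoldingE k T s :
  unfolding k T (enum_rank (row_part k s)) (enum_rank (col_part k s)) = T s.
Proof. by rewrite mxE !enum_rankK merge_parts. Qed.

Lemma unfoldingP k T (M : 'M[R]_(#|row_index d k|, #|col_index d k|)) :
  (forall s, T s = M (enum_rank (row_part k s)) (enum_rank (col_part k s))) ->
  unfolding k T = M.
Proof.
move=> TM; apply/matrixP => a b; rewrite mxE TM row_part_merge col_part_merge.
by rewrite !enum_valK.
Qed.

Lemma unfolding_inj k : injective (@unfolding R N d k).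
Proof.
by move=> T T' TT'; apply/ffunP => s; rewrite -!(unfoldingE k) TT'.
Qed.

Lemma unfoldingD k T T' : unfolding k (T + T') = unfolding k T + unfolding k T'.
Proof. by apply/matrixP => a b; rewrite !mxE ffunE. Qed.

Lemma unfoldingB k T T' : unfolding k (T - T') = unfolding k T - unfolding k T'.
Proof. by apply/matrixP => a b; rewrite !mxE !ffunE. Qed.

Lemma unfoldingZ k c T : unfolding k (c *: T) = c *: unfolding k T.
Proof. by apply/matrixP => a b; rewrite !mxE ffunE. Qed.

Lemma tnorm2_unfolding k T : tnorm2 T = frob2 (unfolding k T).
Proof.
transitivity (\sum_s T (merge_index (row_part k s) (col_part k s)) ^+ 2).
  by apply: eq_bigr => s _; rewrite merge_parts.
rewrite (sum_merge (fun a b => T (merge_index a b) ^+ 2)) /frob2.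
rewrite -(sum_enum_val (fun a => \sum_b T (merge_index a b) ^+ 2)).
apply: eq_bigr => a _.
rewrite -(sum_enum_val (fun b => T (merge_index (enum_val a) b) ^+ 2)).
by apply: eq_bigr => b _; rewrite mxE.
Qed.

(* Appends the slices [Y x] to a matrix whose rows are indexed by the first [i]
   modes: the matrix [(P (x) I) L(Y)] of the literature. *)
Definition row_extend (i : 'I_N) p q (P : 'M[R]_(#|row_index d i|, p))
    (Y : 'I_(d i) -> 'M[R]_(p, q)) : 'M[R]_(#|row_index d i.+1|, q) :=
  \matrix_(a, j) (P *m Y (row_last (enum_val a)))
                    (enum_rank (row_head (enum_val a))) j.

Definition col_extend (i : 'I_N) p q (Y : 'I_(d i) -> 'M[R]_(p, q))
    (V : 'M[R]_(q, #|col_index d i.+1|)) : 'M[R]_(p, #|col_index d i|) :=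
  \matrix_(j, b) (Y (col_head (enum_val b)) *m V)
                    j (enum_rank (col_tail (enum_val b))).

Lemma row_extendBl (i : 'I_N) p q (P P' : 'M[R]_(#|row_index d i|, p))
    (Y : 'I_(d i) -> 'M[R]_(p, q)) :
  row_extend (P - P') Y = row_extend P Y - row_extend P' Y.
Proof. by apply/matrixP => a j; rewrite mxE mulmxBl !mxE. Qed.

Lemma row_extendBr (i : 'I_N) p q (P : 'M[R]_(#|row_index d i|, p))
    (Y Y' : 'I_(d i) -> 'M[R]_(p, q)) :
  row_extend P (fun x => Y x - Y' x) = row_extend P Y - row_extend P Y'.
Proof. by apply/matrixP => a j; rewrite mxE mulmxBr !mxE. Qed.

Lemma col_extendBl (i : 'I_N) p q (Y Y' : 'I_(d i) -> 'M[R]_(p, q))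
    (V : 'M[R]_(q, #|col_index d i.+1|)) :
  col_extend (fun x => Y x - Y' x) V = col_extend Y V - col_extend Y' V.
Proof. by apply/matrixP => a j; rewrite mxE mulmxBl !mxE. Qed.

Lemma col_extendBr (i : 'I_N) p q (Y : 'I_(d i) -> 'M[R]_(p, q))
    (V V' : 'M[R]_(q, #|col_index d i.+1|)) :
  col_extend Y (V - V') = col_extend Y V - col_extend Y V'.
Proof. by apply/matrixP => a j; rewrite mxE mulmxBr !mxE. Qed.

Lemma row_extend_mulmx (i : 'I_N) p q t (P : 'M[R]_(#|row_index d i|, p))
    (Y : 'I_(d i) -> 'M[R]_(p, q)) (W : 'M[R]_(q, t)) :
  row_extend P Y *m W = row_extend P (fun x => Y x *m W).
Proof.
apply/matrixP => a j; rewrite [RHS]mxE mulmxA [LHS]mxE [RHS]mxE.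
by apply: eq_bigr => k _; rewrite [row_extend _ _ _ _]mxE.
Qed.

Lemma mulmx_col_extend (i : 'I_N) p q t (W : 'M[R]_(t, p))
    (Y : 'I_(d i) -> 'M[R]_(p, q)) (V : 'M[R]_(q, #|col_index d i.+1|)) :
  W *m col_extend Y V = col_extend (fun x => W *m Y x) V.
Proof.
apply/matrixP => j b; rewrite [RHS]mxE -mulmxA [LHS]mxE [RHS]mxE.
by apply: eq_bigr => k _; rewrite [col_extend _ _ _ _]mxE.
Qed.

Lemma row_extend_comp (i : 'I_N) p p' q (P : 'M[R]_(#|row_index d i|, p))
    (W : 'M[R]_(p, p')) (Y : 'I_(d i) -> 'M[R]_(p', q)) :
  row_extend (P *m W) Y = row_extend P (fun x => W *m Y x).
Proof. by apply/matrixP => a j; rewrite mxE [RHS]mxE mulmxA. Qed.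

Lemma col_extend_comp (i : 'I_N) p q q' (Y : 'I_(d i) -> 'M[R]_(p, q))
    (W : 'M[R]_(q, q')) (V : 'M[R]_(q', #|col_index d i.+1|)) :
  col_extend Y (W *m V) = col_extend (fun x => Y x *m W) V.
Proof. by apply/matrixP => a j; rewrite mxE [RHS]mxE mulmxA. Qed.

Lemma eq_row_extend (i : 'I_N) p q (P : 'M[R]_(#|row_index d i|, p))
    (Y Y' : 'I_(d i) -> 'M[R]_(p, q)) :
  Y =1 Y' -> row_extend P Y = row_extend P Y'.
Proof. by move=> YY'; apply/matrixP => a j; rewrite mxE YY' [RHS]mxE. Qed.

Lemma eq_col_extend (i : 'I_N) p q (Y Y' : 'I_(d i) -> 'M[R]_(p, q))
    (V : 'M[R]_(q, #|col_index d i.+1|)) :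
  Y =1 Y' -> col_extend Y V = col_extend Y' V.
Proof. by move=> YY'; apply/matrixP => a j; rewrite mxE YY' [RHS]mxE. Qed.

Lemma row_extend_partE (i : 'I_N) p q (P : 'M[R]_(#|row_index d i|, p))
    (Y : 'I_(d i) -> 'M[R]_(p, q)) s j :
  row_extend P Y (enum_rank (row_part i.+1 s)) j =
  (P *m Y (s i)) (enum_rank (row_part i s)) j.
Proof. by rewrite mxE enum_rankK row_last_part row_head_part. Qed.

Lemma col_extend_partE (i : 'I_N) p q (Y : 'I_(d i) -> 'M[R]_(p, q))
    (V : 'M[R]_(q, #|col_index d i.+1|)) s j :
  col_extend Y V j (enum_rank (col_part i s)) =
  (Y (s i) *m V) j (enum_rank (col_part i.+1 s)).
Proof. by rewrite mxE enum_rankK col_head_part col_tail_part. Qed.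

(** Mode [i] can be absorbed on either side of the cut. This is the inductive step showing that all
    cuts of a train yield the same tensor. *)
Lemma extend_shift (i : 'I_N) p q (P : 'M[R]_(#|row_index d i|, p))
    (Y : 'I_(d i) -> 'M[R]_(p, q)) (V : 'M[R]_(q, #|col_index d i.+1|)) s :
  (row_extend P Y *m V) (enum_rank (row_part i.+1 s)) (enum_rank (col_part i.+1 s)) =
  (P *m col_extend Y V) (enum_rank (row_part i s)) (enum_rank (col_part i s)).
Proof.
rewrite row_extend_mulmx row_extend_partE mulmx_col_extend col_extend_partE.
by rewrite mulmxA.
Qed.

Section Gram.
Variable s0 : multi_index d.

Lemma row_extend_gram (i : 'I_N) p p' q q'
    (P : 'M[R]_(#|row_index d i|, p)) (P' : 'M[R]_(#|row_index d i|, p'))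
    (Y : 'I_(d i) -> 'M[R]_(p, q)) (Y' : 'I_(d i) -> 'M[R]_(p', q')) :
  (row_extend P Y)^T *m row_extend P' Y' =
    \sum_x (Y x)^T *m (P^T *m P') *m Y' x.
Proof.
apply/matrixP => j k; rewrite mxE summxE.
pose F (a : row_index d i) x :=
  (P *m Y x) (enum_rank a) j * (P' *m Y' x) (enum_rank a) k.
transitivity (\sum_(a : row_index d i.+1) F (row_head a) (row_last a)).
  rewrite -[RHS]sum_enum_val; apply: eq_bigr => a _.
  by rewrite [_^T _ _]mxE [row_extend _ _ _ _]mxE [row_extend _ _ _ _]mxE.
rewrite (sum_row_index s0) exchange_big; apply: eq_bigr => x _ /=.
rewrite -[LHS]sum_enum_val mulmxA -trmx_mul -mulmxA [RHS]mxE. apply: eq_bigr => a _.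
by rewrite /F enum_valK [_^T _ _]mxE.
Qed.

Lemma col_extend_gram (i : 'I_N) p p' q q'
    (Y : 'I_(d i) -> 'M[R]_(p, q)) (Y' : 'I_(d i) -> 'M[R]_(p', q'))
    (V : 'M[R]_(q, #|col_index d i.+1|)) (V' : 'M[R]_(q', #|col_index d i.+1|)) :
  col_extend Y V *m (col_extend Y' V')^T =
    \sum_x Y x *m (V *m V'^T) *m (Y' x)^T.
Proof.
apply/matrixP => j k; rewrite mxE summxE.
pose F x (b : col_index d i.+1) :=
  (Y x *m V) j (enum_rank b) * (Y' x *m V') k (enum_rank b).
transitivity (\sum_(b : col_index d i) F (col_head b) (col_tail b)).
  rewrite -[RHS]sum_enum_val; apply: eq_bigr => a _.
  by rewrite [_^T _ _]mxE [col_extend _ _ _ _]mxE [col_extend _ _ _ _]mxE.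
rewrite (sum_col_index s0); apply: eq_bigr => x _ /=.
rewrite -[LHS]sum_enum_val mulmxA -mulmxA -trmx_mul [RHS]mxE; apply: eq_bigr => b _.
by rewrite /F enum_valK [_^T _ _]mxE.
Qed.

Lemma frob2_row_extend (i : 'I_N) p q t (P : 'M[R]_(#|row_index d i|, p))
    (Y : 'I_(d i) -> 'M[R]_(p, q)) (W : 'M[R]_(q, t)) :
  frob2 (row_extend P Y *m W) = \sum_x frob2 (P *m (Y x *m W)).
Proof.
rewrite row_extend_mulmx frob2E /mxdot row_extend_gram raddf_sum.
apply: eq_bigr => x _; rewrite frob2E /mxdot [in RHS]trmx_mul.
by rewrite !mulmxA.
Qed.

Lemma frob2_col_extend (i : 'I_N) p q t (W : 'M[R]_(t, p))
    (Y : 'I_(d i) -> 'M[R]_(p, q)) (V : 'M[R]_(q, #|col_index d i.+1|)) :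
  frob2 (W *m col_extend Y V) = \sum_x frob2 (W *m Y x *m V).
Proof.
rewrite mulmx_col_extend -frob2_tr frob2E /mxdot trmxK col_extend_gram raddf_sum.
apply: eq_bigr => x _; rewrite -frob2_tr frob2E /mxdot trmxK.
by rewrite [in RHS]trmx_mul !mulmxA.
Qed.

End Gram.

Lemma lunfold_gram n p q q' (Y : 'I_n -> 'M[R]_(p, q)) (Y' : 'I_n -> 'M[R]_(p, q')) :
  (lunfold Y)^T *m lunfold Y' = \sum_x (Y x)^T *m Y' x.
Proof. by rewrite /lunfold tr_mxcol mul_mxrow_mxcol. Qed.

Lemma frob2_lunfold n p q t (Y : 'I_n -> 'M[R]_(p, q)) (W : 'M[R]_(q, t)) :
  frob2 (lunfold Y *m W) = \sum_x frob2 (Y x *m W).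
Proof.
rewrite frob2E mxdot_mulmxl mulmxA lunfold_gram mulmx_suml mxdot_sumr.
by apply: eq_bigr => x _; rewrite frob2E mxdot_mulmxl mulmxA.
Qed.

Lemma lunfoldB n p q (Y Y' : 'I_n -> 'M[R]_(p, q)) :
  lunfold Y - lunfold Y' = lunfold (fun x => Y x - Y' x).
Proof. by rewrite /lunfold mxcolB. Qed.

End Unfolding.

(** * Interface matrices of a tensor train *)

Section Interfaces.
Variables (R : realType) (N : nat) (d : 'I_N -> nat) (r : nat -> nat).
Implicit Types X Z : factors R d r.

(* The [k]-th unfolding of a tensor train factors as [lface X k *m rface X k],
   see [unfolding_tt]. *)
Fixpoint lface X k : 'M[R]_(#|row_index d k|, r k) :=
  match k with
  | 0 => const_mx 1
  | k'.+1 => match @boolP (k' < N)%N with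
             | AltTrue h => @row_extend R N d (Ordinal h) _ _ (lface X k') (X
               (Ordinal h))
             | AltFalse _ => 0
             end
  end.

(** Right interfaces recurse towards larger [k]; the number [j] of modes left to absorb makes the
    recursion structural, and [rface] starts it at [N - k]. *)
Fixpoint rface_rec X j k : 'M[R]_(r k, #|col_index d k|) :=
  match j with
  | 0 => const_mx 1
  | j'.+1 => match @boolP (k < N)%N with
             | AltTrue h => @col_extend R N d (Ordinal h) _ _ (X (Ordinal h))
               (rface_rec X j' k.+1)
             | AltFalse _ => 0
             end
  end.

Definition rface X k := rface_rec X (N - k) k.

Lemma lfaceS X (i : 'I_N) : lface X i.+1 = row_extend (lface X i) (X i).
Proof. by case: i => k h /=; rewrite (boolP_true _ _ h). Qed.

Lemma rfaceN X : rface X N = const_mx 1.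
Proof. by rewrite /rface subnn. Qed.

Lemma rfaceS X (i : 'I_N) : rface X i = col_extend (X i) (rface X i.+1).
Proof.
case: i => k h /=; rewrite /rface -(subnSK h) /=.
by rewrite (boolP_true _ _ h).
Qed.

Lemma eq_lface X Z k : (k <= N)%N ->
  (forall j : 'I_N, (j < k)%N -> X j = Z j) -> lface X k = lface Z k.
Proof.
elim: k => [//|k IH] kN XZ; rewrite -[k]/(val (Ordinal kN)) !lfaceS /=.
by rewrite IH ?(ltnW kN) // ?XZ // => j jk; rewrite XZ // ltnW.
Qed.

Lemma rface_ind (P : nat -> Prop) :
  P N -> (forall i : 'I_N, P i.+1 -> P i) -> forall k, (k <= N)%N -> P k.
Proof.
move=> PN PS k kN; rewrite -(subKn kN); elim: (N - k)%N (leq_subr k N) => [|j IH] jN.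
  by rewrite subn0.
have h : (N - j.+1 < N)%N by rewrite ltn_subrL; case: (N) jN.
by apply: (PS (Ordinal h)); rewrite /= subnSK //; apply: IH; exact: ltnW.
Qed.

Lemma eq_rface X Z k : (k <= N)%N ->
  (forall j : 'I_N, (k <= j)%N -> X j = Z j) -> rface X k = rface Z k.
Proof.
elim/rface_ind: k / => [|i IH] XZ; first by rewrite !rfaceN.
by rewrite !rfaceS XZ // IH // => j ij; rewrite XZ // ltnW.
Qed.

Section TensorTrain.
Hypotheses (hr0 : r 0%N = 1%N) (hrN : r N = 1%N).

(** As [r 0] and [r N] equal 1 only propositionally, constant vectors of ones at both ends play the
    part of the scalar 1 and avoid casts. *)
Lemma lface_tt_prod X s k (h : (k <= N)%N) j :
  lface X k (enum_rank (row_part k s)) j =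
  ((const_mx 1 : 'rV[R]_(r 0)) *m tt_prod X s h) 0 j.
Proof.
elim: k h j => [|k IH] h j; first by rewrite mulmx1 !mxE.
rewrite -[k.+1]/(val (Ordinal h)).+1 lfaceS row_extend_partE /= mulmxA.
rewrite mxE [RHS]mxE; apply: eq_bigr => l _; congr (_ * _).
exact: (IH (ltnW h)).
Qed.

Lemma tt_tensorE X s :
  tt_tensor X s = ((const_mx 1 : 'rV[R]_(r 0)) *m tt_prod X s (leqnn N)
                    *m (const_mx 1 : 'cV[R]_(r N))) 0 0.
Proof.
rewrite ffunE; move: (tt_prod X s (leqnn N)); rewrite hr0 hrN => M.
by rewrite conform_mx_id !mxE big_ord1 !mxE big_ord1 !mxE mul1r mulr1.
Qed.

Lemma face_tt_tensor X k s : (k <= N)%N ->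
  (lface X k *m rface X k) (enum_rank (row_part k s)) (enum_rank (col_part k s))
    = tt_tensor X s.
Proof.
elim/rface_ind: k / => [|i IH].
  rewrite rfaceN tt_tensorE mxE [RHS]mxE; apply: eq_bigr => j _.
  by rewrite (lface_tt_prod _ _ (leqnn N)) [const_mx _ _ _]mxE [const_mx _ _ _]mxE.
by rewrite -IH lfaceS extend_shift rfaceS.
Qed.

Lemma unfolding_tt X k : (k <= N)%N ->
  unfolding k (tt_tensor X) = lface X k *m rface X k.
Proof. by move=> kN; apply: unfoldingP => s; rewrite face_tt_tensor. Qed.

Lemma unfolding_tt_split X (i : 'I_N) :
  unfolding i.+1 (tt_tensor X) = row_extend (lface X i) (X i) *m rface X i.+1.
Proof. by rewrite unfolding_tt ?lfaceS. Qed.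

Lemma tt_rank_le X k : (k <= N)%N -> (tt_rank (tt_tensor X) k <= r k)%N.
Proof.
move=> kN; rewrite /tt_rank unfolding_tt //.
exact: leq_trans (mxrankM_maxl _ _) (rank_leq_col _).
Qed.

Variable s0 : multi_index d.

Lemma gram_lface0 X : (lface X 0)^T *m lface X 0 = 1%:M.
Proof.
apply/matrixP => i j; rewrite /= mxE.
under eq_bigr do rewrite !mxE mulr1.
rewrite sumr_const card_ord (card_row0 s0) [RHS]mxE.
by move: i j; rewrite hr0 => i j; rewrite !ord1.
Qed.

Lemma gram_rfaceN X : rface X N *m (rface X N)^T = 1%:M.
Proof.
rewrite rfaceN; apply/matrixP => i j; rewrite /= mxE.
under eq_bigr do rewrite !mxE mulr1.
rewrite sumr_const card_ord (card_colN s0) [RHS]mxE.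
by move: i j; rewrite hrN => i j; rewrite !ord1.
Qed.

(** Orthonormality propagates through the Gram formula of [row_extend], one left unfolding at a
    time. It stops before [N] because the last factor is unconstrained. *)
Lemma gram_lface X k : left_orthogonal X -> (k < N)%N ->
  (lface X k)^T *m lface X k = 1%:M.
Proof.
move=> Xo; elim: k => [|k IH] kN; first exact: gram_lface0.
have kN' : (k < N)%N := ltnW kN.
rewrite -[k.+1]/(val (Ordinal kN')).+1 lfaceS (row_extend_gram s0) IH //.
by rewrite -(Xo (Ordinal kN') kN) lunfold_gram; apply: eq_bigr => x _; rewrite mulmx1.
Qed.

End TensorTrain.

(** * Invariance of a train under rotations of its bonds *)

Section Rotation.
Variable Q : forall k : nat, 'M[R]_(r k).
Hypothesis hQ : rotations R N r Q.

Lemma rotation_orth k : (Q k)^T *m Q k = 1%:M.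
Proof. by have [Qo _] := hQ; exact: Qo. Qed.

Lemma rotation_orthC k : Q k *m (Q k)^T = 1%:M.
Proof. exact/mulmx1C/rotation_orth. Qed.

Lemma lface_rotate X k : (k <= N)%N -> lface (rotate Q X) k = lface X k *m Q k.
Proof.
elim: k => [_|k IH kN]; first by have [_ [-> _]] := hQ; rewrite mulmx1.
rewrite -[k.+1]/(val (Ordinal kN)).+1 !lfaceS IH ?(ltnW kN) //.
rewrite row_extend_comp row_extend_mulmx; apply: eq_row_extend => x.
by rewrite /rotate !mulmxA rotation_orthC mul1mx.
Qed.

Lemma rface_rotate X k : (k <= N)%N -> rface (rotate Q X) k = (Q k)^T *m rface X k.
Proof.
elim/rface_ind: k / => [|i IH].
  by rewrite !rfaceN; have [_ [_ ->]] := hQ; rewrite trmx1 mul1mx.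
rewrite !rfaceS IH col_extend_comp mulmx_col_extend; apply: eq_col_extend => x.
by rewrite /rotate -!mulmxA rotation_orthC mulmx1.
Qed.

Lemma left_orthogonal_rotate X : left_orthogonal X -> left_orthogonal (rotate Q X).
Proof.
move=> Xo i iN; rewrite lunfold_gram.
have -> : 1%:M = (Q i.+1)^T *m 1%:M *m Q i.+1 by rewrite mulmx1 rotation_orth.
rewrite -(Xo i iN) lunfold_gram mulmx_sumr mulmx_suml; apply: eq_bigr => x _;
  rewrite /rotate !trmx_mul trmxK !mulmxA.
by rewrite -(mulmxA _ (Q i)) rotation_orthC mulmx1.
Qed.

Lemma tt_tensor_rotate X : r 0%N = 1%N -> r N = 1%N ->
  tt_tensor (rotate Q X) = tt_tensor X.
Proof.
move=> hr0 hrN; apply: (@unfolding_inj _ _ _ N).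
rewrite !unfolding_tt // lface_rotate // rface_rotate //.
by rewrite mulmxA -(mulmxA (lface X N)) rotation_orthC mulmx1.
Qed.

End Rotation.

(** * Trains with one factor replaced, and hybrids of two trains *)

Section Replacement.
Hypotheses (hr0 : r 0%N = 1%N) (hrN : r N = 1%N).

Definition replace_factor X (i : 'I_N) (Y : 'I_(d i) -> 'M[R]_(r i, r i.+1)) :
    factors R d r :=
  @dfwith 'I_N (fun j => 'I_(d j) -> 'M[R]_(r j, r j.+1)) X i Y.

(** These hybrids interpolate between [X] at [k = 0] and [Z] at [k = N], so that the difference of
    the two tensors telescopes one factor at a time. *)
Definition mix_factors Z X (k : nat) : factors R d r :=
  fun j => if (j < k)%N then Z j else X j.

Lemma unfolding_replace X (i : 'I_N) Y :
  unfolding i.+1 (tt_tensor (replace_factor X Y)) =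
  row_extend (lface X i) Y *m rface X i.+1.
Proof.
rewrite unfolding_tt_split // {2}/replace_factor dfwithin.
rewrite (@eq_lface _ X) ?(ltnW (ltn_ord i)) //; last first.
  by move=> j ji; rewrite /replace_factor dfwithout // -val_eqE /= gtn_eqF.
rewrite (@eq_rface _ X) // => j ij.
by rewrite /replace_factor dfwithout // -val_eqE /= ltn_eqF.
Qed.

Lemma unfolding_mix Z X (i : 'I_N) :
  unfolding i.+1 (tt_tensor (mix_factors Z X i)) =
  row_extend (lface Z i) (X i) *m rface X i.+1.
Proof.
rewrite unfolding_tt_split // {2}/mix_factors ltnn.
rewrite (@eq_lface _ Z) ?(ltnW (ltn_ord i)) //; last by move=> j;
  rewrite /mix_factors => ->.
by rewrite (@eq_rface _ X) // => j ij; rewrite /mix_factors ltnNge ltnW.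
Qed.

Lemma unfolding_mixS Z X (i : 'I_N) :
  unfolding i.+1 (tt_tensor (mix_factors Z X i.+1)) =
  row_extend (lface Z i) (Z i) *m rface X i.+1.
Proof.
rewrite unfolding_tt_split // {2}/mix_factors ltnSn.
rewrite (@eq_lface _ Z) ?(ltnW (ltn_ord i)) //; last first.
  by move=> j ji; rewrite /mix_factors ltnS ltnW.
by rewrite (@eq_rface _ X) // => j ij; rewrite /mix_factors ltnNge ij.
Qed.

Lemma mix_factors0 Z X : mix_factors Z X 0 = X.
Proof. by []. Qed.

Lemma tt_mix_factorsN Z X : tt_tensor (mix_factors Z X N) = tt_tensor Z.
Proof.
apply: (@unfolding_inj _ _ _ N); rewrite !unfolding_tt // !rfaceN.
by rewrite (@eq_lface _ Z) // => j; rewrite /mix_factors => ->.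
Qed.

End Replacement.
End Interfaces.

(** * Gradient of the loss *)

Section Gradient.
Variable R : realType.

Lemma derive_quadratic m n (f : 'M[R]_(m, n) -> R) (L V : 'M[R]_(m, n)) (b c : R) :
  (forall h, f (h *: V + L) = f L + h * b + h ^+ 2 * c) -> 'D_V f L = b.
Proof.
move=> fE; rewrite /derive; apply: cvg_lim => //.
have bE : b = b + 0 * c by rewrite mul0r addr0.
rewrite [X in _ --> X]bE.
apply: (@cvg_trans _ ((fun h : R => b + h * c) @ 0^')).
  apply: near_eq_cvg; near=> h.
  have h0 : h != 0 by near: h; exact: nbhs_dnbhs_neq.
  by rewrite /= fE /GRing.scale /=; field.
apply: cvg_within_filter; apply: cvgD; first exact: cvg_cst.
by apply: cvgMl; exact: cvg_id.
Unshelve. all: by end_near. Qed.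

Lemma mxdot_sum m n (A B : 'M[R]_(m, n)) :
  mxdot A B = \sum_i \sum_j A i j * B i j.
Proof.
rewrite /mxdot /mxtrace exchange_big /=; apply: eq_bigr => j _.
by rewrite mxE; apply: eq_bigr => i _; rewrite mxE.
Qed.

Lemma lfold_lunfold n p q (Y : 'I_n -> 'M[R]_(p, q)) x : lfold (lunfold Y) x = Y x.
Proof. exact: mxcolK. Qed.

Lemma lunfold_lfold n p q (M : 'M[R]_(\sum_(s < n) p, q)) : lunfold (lfold M) = M.
Proof. exact: submxcolK. Qed.

Variables (N : nat) (d : 'I_N -> nat) (r : nat -> nat).
Hypotheses (hr0 : r 0%N = 1%N) (hrN : r N = 1%N).
Implicit Types (X : factors R d r) (i : 'I_N).

Lemma tt_replace_lin X i c (M M' : 'M[R]_(\sum_(s < d i) r i, r i.+1)) :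
  tt_tensor (replace_factor X (lfold (c *: M + M'))) =
  c *: tt_tensor (replace_factor X (lfold M)) + tt_tensor (replace_factor X
    (lfold M')).
Proof.
apply: (@unfolding_inj _ _ _ i.+1).
rewrite unfoldingD unfoldingZ !unfolding_replace // scalemxAl -mulmxDl;
  congr (_ *m _).
apply/matrixP => a j; rewrite [LHS]mxE [RHS]mxE [X in _ = X + _]mxE.
rewrite [row_extend _ _ _ _]mxE [X in _ = _ + X]mxE.
set x := row_last _; set b := enum_rank _.
have -> : lfold (c *: M + M') x = c *: lfold M x + lfold M' x.
  by apply/matrixP => k l; rewrite !mxE.
by rewrite mulmxDr -scalemxAr mxE; congr (_ + _); rewrite mxE.
Qed.

Lemma tt_replace_self X i : tt_tensor (replace_factor X (lfold (lunfold (X i))))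
  = tt_tensor X.
Proof.
apply: (@unfolding_inj _ _ _ i.+1).
rewrite unfolding_replace // unfolding_tt_split //; congr (_ *m _).
by apply: eq_row_extend => x; rewrite lfold_lunfold.
Qed.

Lemma eq_tt_replace X i (Y Y' : 'I_(d i) -> 'M[R]_(r i, r i.+1)) : Y =1 Y' ->
  tt_tensor (replace_factor X Y) = tt_tensor (replace_factor X Y').
Proof.
move=> YY'; apply: (@unfolding_inj _ _ _ i.+1).
by rewrite !unfolding_replace // (eq_row_extend _ YY').
Qed.

(** The tensor is linear in each single factor, so the loss is quadratic along every coordinate
    direction and its derivative is the linear coefficient. Summing over coordinates recombines, by
    linearity, into the train whose factor [i] is [Y]; from here on gradients are only seen through
    such pairings. *)
Lemma mxdot_grad_factor X i m (A : {linear tensor R d -> 'cV[R]_m}) (y : 'cV[R]_m)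
    (Y : 'I_(d i) -> 'M[R]_(r i, r i.+1)) :
  mxdot (grad_factor (sensing_loss A y) X i) (lunfold Y) =
  m%:R^-1 * mxdot (A (tt_tensor X) - y) (A (tt_tensor (replace_factor X Y))).
Proof.
pose T (M : 'M[R]_(\sum_(s < d i) r i, r i.+1)) := tt_tensor (replace_factor X
  (lfold M)) : tensor R d.
pose E := A (tt_tensor X) - y.
have gradE a b : grad_factor (sensing_loss A y) X i a b =
    m%:R^-1 * mxdot E (A (T (delta_mx a b))).
  rewrite mxE; apply: (@derive_quadratic _ _ _ _ _ _
    ((2 * m%:R)^-1 * frob2 (A (T (delta_mx a b))))) => h.
  rewrite /sensing_loss -/(replace_factor _ _) -/(replace_factor _ _).
  rewrite tt_replace_lin tt_replace_self -/(T _) linearD linearZ /=.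
  rewrite -addrA -/E frob2D frob2Z mxdotZl (mxdotC _ E) invfM.
  (* [m] may be 0, so its inverse is abstracted and [field] has to divide by 2 only. *)
  by move: (m%:R^-1) (mxdot _ _) (frob2 _) (frob2 _) => k u v w; field.
have Tlin c M M' : T (c *: M + M') = c *: T M + T M' by exact: tt_replace_lin.
have T0 : T 0 = 0.
  by have := Tlin (-1) 0 0; rewrite !scaleN1r oppr0 addr0 addNr.
have TD M M' : T (M + M') = T M + T M' by have := Tlin 1 M M'; rewrite !scale1r.
have TZ c M : T (c *: M) = c *: T M by have := Tlin c M 0; rewrite T0 !addr0.
rewrite -(@eq_tt_replace X i (lfold (lunfold Y))); last exact: lfold_lunfold.
rewrite -/(T _) [in RHS](matrix_sum_delta (lunfold Y)).
rewrite (big_morph T TD T0) linear_sum mxdot_sumr mulr_sumr mxdot_sum.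
apply: eq_bigr => a _; rewrite (big_morph T TD T0) linear_sum mxdot_sumr mulr_sumr.
by apply: eq_bigr => b _; rewrite gradE TZ linearZ /= mxdotZr mulrCA mulrC.
Qed.

End Gradient.

(** * Comparison of two tensor trains *)

Section Sums.
Variable R : realType.

(** The ordered products on the right are those in which the second-order errors of the successive
    factors are bounded; this form lets [regularity] complete the square. *)
Lemma sqr_sum_ord n (x : 'I_n -> R) :
  (\sum_i x i) ^+ 2 =
  \sum_i x i ^+ 2 + 2 * \sum_i x i * \sum_(j < n | (j < i)%N) x j.
Proof.
elim: n x => [|n IH] x; first by rewrite !big_ord0 mulr0 addr0 expr0n.
rewrite !big_ord_recr /= sqrrD IH.
have -> : \sum_(j < n.+1 | (j < n)%N) x j = \sum_(j < n) x (widen_ord (leqnSn n) j).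
  rewrite big_mkcond big_ord_recr /= ltnn addr0.
  by apply: eq_bigr => j _; rewrite /= ltn_ord.
have -> : \sum_(i < n) x (widen_ord (leqnSn n) i) * \sum_(j < n.+1 | (j < i)%N) x j =
    \sum_(i < n) x (widen_ord (leqnSn n) i) *
      \sum_(j < n | (j < i)%N) x (widen_ord (leqnSn n) j).
  apply: eq_bigr => i _; congr (_ * _).
  rewrite big_mkcond big_ord_recr /= [(n < i)%N]ltnNge (ltnW (ltn_ord i)) addr0.
  by rewrite [RHS]big_mkcond.
by rewrite -mulr_natl; ring.
Qed.

Lemma sqr_sum_le n (x : 'I_n -> R) : (\sum_i x i) ^+ 2 <= n%:R * \sum_i x i ^+ 2.
Proof.
have := mxdot_cauchy (\row_i x i) (const_mx 1 : 'rV[R]_n).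
have -> : mxdot (\row_i x i) (const_mx 1 : 'rV[R]_n) = \sum_i x i.
  by rewrite mxdot_sum big_ord1; apply: eq_bigr => i _; rewrite !mxE mulr1.
have -> : frob2 (const_mx 1 : 'rV[R]_n) = n%:R.
  rewrite /frob2 big_ord1; under eq_bigr do rewrite mxE expr1n.
  by rewrite sumr_const card_ord.
have -> : frob2 (\row_i x i) = \sum_i x i ^+ 2.
  by rewrite /frob2 big_ord1; apply: eq_bigr => i _; rewrite mxE.
by rewrite mulrC.
Qed.

End Sums.

(** * Perturbation bounds for two nearby left-orthogonal trains *)

Section TwoTrains.
Variables (R : realType) (N : nat) (d : 'I_N -> nat) (r : nat -> nat).
Hypotheses (hr0 : r 0%N = 1%N) (hrN : r N = 1%N).
Variable s0 : multi_index d.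

Lemma frob2_row_extend_orth (i : 'I_N) p q (P : 'M[R]_(#|row_index d i|, p))
    (Y : 'I_(d i) -> 'M[R]_(p, q)) t (W : 'M[R]_(q, t)) :
  P^T *m P = 1%:M -> frob2 (row_extend P Y *m W) = frob2 (lunfold Y *m W).
Proof.
move=> P1; rewrite (frob2_row_extend s0) frob2_lunfold.
by apply: eq_bigr => x _; rewrite mul_orthomx_frob2.
Qed.

Lemma fnorm_row_extend_le (i : 'I_N) p q (P : 'M[R]_(#|row_index d i|, p)) c
    (Y : 'I_(d i) -> 'M[R]_(p, q)) t (W : 'M[R]_(q, t)) : 0 <= c ->
  (forall V : 'M[R]_(p, t), fnorm (P *m V) <= c * fnorm V) ->
  fnorm (row_extend P Y *m W) <= c * fnorm (lunfold Y *m W).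
Proof.
move=> c0 Pc; apply: fnorm_le => //.
rewrite (frob2_row_extend s0) frob2_lunfold mulr_sumr; apply: ler_sum => x _.
rewrite -!sqr_fnorm -exprMn ler_pXn2r ?nnegrE ?mulr_ge0 ?fnorm_ge0 //.
Qed.

Lemma frob2_col_extend1 (i : 'I_N) p q (Y : 'I_(d i) -> 'M[R]_(p, q))
    (V : 'M[R]_(q, #|col_index d i.+1|)) :
  frob2 (col_extend Y V) = frob2 (lunfold Y *m V).
Proof.
rewrite -[col_extend Y V]mul1mx (frob2_col_extend s0) frob2_lunfold.
by apply: eq_bigr => x _; rewrite mul1mx.
Qed.

Lemma fnorm_mulmx m n p (A : 'M[R]_(m, n)) (B : 'M[R]_(n, p)) :
  fnorm (A *m B) <= fnorm A * fnorm B.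
Proof. by apply: fnorm_le; rewrite ?fnorm_ge0 // sqr_fnorm frob2_mulmx. Qed.

Lemma mul_orthomx_fnorm m n p (U : 'M[R]_(m, n)) (W : 'M[R]_(n, p)) :
  U^T *m U = 1%:M -> fnorm (U *m W) = fnorm W.
Proof. by move=> U1; rewrite /fnorm mul_orthomx_frob2. Qed.

Variables X Z : factors R d r.
Arguments X : clear implicits.
Arguments Z : clear implicits.
Hypotheses (Xo : left_orthogonal X) (Zo : left_orthogonal Z).
Variable s : R.
Hypothesis s_gt0 : 0 < s.
Hypothesis Zs : forall k, (0 < k < N)%N ->
  forall p (W : 'M[R]_(p, r k)), fnorm (W *m rface Z k) <= s * fnorm W.

(** The square root of the weight of a factor in the distance. It also bounds the norm of the right
    interface of [Z] at [k], which makes [wgap] the natural size of the effect of one factor on the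
    tensor. *)
Definition weight (k : nat) : R := if k == N then 1 else s.

Definition gap (i : 'I_N) : R :=
  fnorm (lunfold (fun x => X i x - Z i x)).

Definition wgap (i : 'I_N) : R := weight i.+1 * gap i.

Lemma weight_gt0 k : 0 < weight k.
Proof. by rewrite /weight; case: ifP. Qed.

Lemma gap_ge0 i : 0 <= gap i. Proof. exact: fnorm_ge0. Qed.

Lemma wgap_ge0 i : 0 <= wgap i.
Proof. by rewrite mulr_ge0 ?gap_ge0 // ltW ?weight_gt0. Qed.

Lemma fnorm_mul_rface k p (W : 'M[R]_(p, r k)) : (0 < k <= N)%N ->
  fnorm (W *m rface Z k) <= weight k * fnorm W.
Proof.
case/andP => k0; rewrite leq_eqVlt /weight; case: (eqVneq k N) W => [->|_] W /=.
  move=> _; rewrite mul1r -[leRHS]mul1r; apply: fnorm_le => //.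
  by rewrite expr1n mul1r frob2E mxdot_mulmxr -mulmxA gram_rfaceN // mulmx1 frob2E.
by move=> kN; apply: Zs; rewrite k0.
Qed.

Hypothesis small : \sum_i wgap i <= s / 3.

(** Its second premise is the conclusion of [rface_diff] at the same [k], so the two bounds can be
    proved together going down from [N]. The constants close up: [3/2] times [s / 3] is [s / 2], the
    admissible perturbation of an interface of norm [s]; at [k = N] the sum is empty. *)
Lemma fnorm_mul_rface_of_diff k p (W : 'M[R]_(p, r k)) : (0 < k <= N)%N ->
  fnorm (rface X k - rface Z k) <= 3 / 2 * \sum_(i < N | (k <= i)%N) wgap i ->
  fnorm (W *m rface X k) <= 3 / 2 * weight k * fnorm W.
Proof.
move=> k0N hk; rewrite -[rface X k](subrK (rface Z k)) mulmxDr.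
apply: le_trans (fnormD _ _) _.
have Wd := fnorm_mulmx W (rface X k - rface Z k).
have WZ := fnorm_mul_rface W k0N.
have W0 := fnorm_ge0 W.
suff : fnorm (rface X k - rface Z k) <= weight k / 2.
  by move=> /(ler_wpM2l W0) Wk; lra.
apply: le_trans hk _.
have [kN|kN] := eqVneq k N.
  rewrite big1 => [|i]; first by rewrite mulr0 divr_ge0 ?ltW ?weight_gt0.
  by rewrite kN leqNgt ltn_ord.
rewrite /weight (negPf kN).
have : \sum_(i < N | (k <= i)%N) wgap i <= \sum_i wgap i.
  rewrite big_mkcond; apply: ler_sum => i _; case: ifP => // _; exact: wgap_ge0.
by move: small => h1 h2; lra.
Qed.

(** The difference at [i] splits into the change of factor [i] in front of the interface of [X], and
    factor [i] of [Z] in front of the difference at [i.+1]. The first costs [3/2 wgap i]; the second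
    keeps its norm, as the left unfolding of [Z] is orthonormal. *)
Lemma rface_diff k : (k <= N)%N ->
  fnorm (rface X k - rface Z k) <= 3 / 2 * \sum_(i < N | (k <= i)%N) wgap i.
Proof.
elim/rface_ind: k / => [|i IH].
  by rewrite !rfaceN subrr fnorm0 mulr_ge0 ?divr_ge0 ?sumr_ge0 // => i _;
    exact: wgap_ge0.
have -> : rface X i - rface Z i =
    col_extend (fun x => X i x - Z i x) (rface X i.+1) +
    col_extend (Z i) (rface X i.+1 - rface Z i.+1).
  by rewrite col_extendBl col_extendBr addrA subrK -!rfaceS.
apply: le_trans (fnormD _ _) _; rewrite (bigD1 i) //= mulrDr lerD //.
  rewrite /fnorm frob2_col_extend1 -/(fnorm _).
  have iN : (0 < i.+1 <= N)%N by rewrite /= ltn_ord.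
  apply: le_trans (fnorm_mul_rface_of_diff _ iN IH) _.
  by rewrite /wgap mulrA.
have -> : \sum_(i0 < N | (i <= i0)%N && (i0 != i)) wgap i0 =
    \sum_(i0 < N | (i.+1 <= i0)%N) wgap i0.
  by apply: eq_bigl => j; rewrite (ltn_neqAle i j) andbC eq_sym.
(* The last factor of [Z] is not orthonormal, but the interface difference behind it is zero. *)
rewrite /fnorm frob2_col_extend1; have [iN|iN] := ltnP i.+1 N.
  by rewrite mul_orthomx_frob2 ?Zo.
have iN' : i.+1 = N by apply/eqP; rewrite eqn_leq ltn_ord.
have -> : rface X i.+1 - rface Z i.+1 = 0 by rewrite iN' !rfaceN subrr.
rewrite mulmx0 frob20 sqrtr0.
by rewrite mulr_ge0 ?divr_ge0 ?sumr_ge0 // => j _; exact: wgap_ge0.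
Qed.

Lemma fnorm_mul_rface_near k p (W : 'M[R]_(p, r k)) : (0 < k <= N)%N ->
  fnorm (W *m rface X k) <= 3 / 2 * weight k * fnorm W.
Proof.
move=> k0N; apply: fnorm_mul_rface_of_diff => //.
by apply: rface_diff; case/andP: k0N.
Qed.

Lemma lface_diff k p (W : 'M[R]_(r k, p)) : (k < N)%N ->
  fnorm ((lface X k - lface Z k) *m W) <= (\sum_(j < N | (j < k)%N) gap j) * fnorm W.
Proof.
elim: k p W => [|k IH] p W kN.
  by rewrite /= subrr mul0mx fnorm0 mulr_ge0 ?fnorm_ge0 // sumr_ge0 // => i _;
    exact: gap_ge0.
have kN' : (k < N)%N := ltnW kN; pose i := Ordinal kN'.
have -> : lface X k.+1 - lface Z k.+1 =
    row_extend (lface X i - lface Z i) (X i) +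
    row_extend (lface Z i) (fun x => X i x - Z i x).
  by rewrite row_extendBl row_extendBr addrA subrK -!lfaceS.
rewrite mulmxDl (bigD1 i) ?leqnn //= mulrDl [leRHS]addrC.
apply: le_trans (fnormD _ _) (lerD _ _); last first.
  rewrite {1}/fnorm (@frob2_row_extend_orth i) ?gram_lface // -/(fnorm _).
  exact: fnorm_mulmx.
(* Left orthogonality of [X] trades [|W|] for [|L(X_i) W|], so that the induction hypothesis,
   applied slice by slice to [X_i(x) W], sums to the right bound. *)
rewrite -[fnorm W](@mul_orthomx_fnorm _ _ _ (lunfold (X i))) ?Xo //.
have -> : \sum_(j < N | (j < k.+1)%N && (j != i)) gap j = \sum_(j < N | (j <
  k)%N) gap j.
  by apply: eq_bigl => j; rewrite ltnS (ltn_neqAle j k) andbC.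
apply: (@fnorm_row_extend_le i) => [|V]; first by apply: sumr_ge0 => j _;
  exact: gap_ge0.
exact: IH.
Qed.

(** The error made when the [i]-th telescoping term of [[X] - [Z]], whose left part comes from [Z],
    is replaced by [X_1 ... (X_i - Z_i) ... X_N]. Written as a combination of three trains, it has
    TT ranks at most [3 r_k]. *)
Definition second_order (i : 'I_N) : tensor R d :=
  tt_tensor (replace_factor X (fun x => X i x - Z i x))
  - tt_tensor (mix_factors Z X i) + tt_tensor (mix_factors Z X i.+1).

Lemma sum_second_order :
  \sum_i second_order i =
  \sum_i tt_tensor (replace_factor X (fun x => X i x - Z i x))
  - (tt_tensor X - tt_tensor Z).
Proof.
rewrite /second_order; under eq_bigr => i _ do rewrite -addrA.
rewrite big_split; congr (_ + _).
have /= := telescope_sumr (fun k => tt_tensor (mix_factors Z X k)) (leq0n N).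
rewrite big_mkord tt_mix_factorsN // mix_factors0 opprB => <-.
by apply: eq_bigr => i _; rewrite addrC.
Qed.

(** The three trains combine into a product of two differences: that of the left interfaces, bounded
    by [lface_diff], and that of factor [i], followed by the right interface of [X]. *)
Lemma fnorm_second_order (i : 'I_N) :
  fnorm (unfolding i.+1 (second_order i)) <=
  3 / 2 * (\sum_(j < N | (j < i)%N) gap j) * wgap i.
Proof.
rewrite unfoldingD unfoldingB unfolding_replace // unfolding_mix // unfolding_mixS //.
rewrite -addrA [- _ + _]addrC -opprB -mulmxBl -row_extendBr -mulmxBl -row_extendBl.
set c := \sum_(j < N | _) _.
have c0 : 0 <= c by apply: sumr_ge0 => j _; exact: gap_ge0.
apply: (@le_trans _ _ (c * fnorm (lunfold (fun x => X i x - Z i x) *m rface X i.+1))).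
  by apply: fnorm_row_extend_le => // V; apply: lface_diff.
have := @fnorm_mul_rface_near i.+1 _ (lunfold (fun x => X i x - Z i x)) (ltn_ord i).
rewrite /wgap -/(gap i) => h.
by apply: le_trans (ler_wpM2l c0 h) _; rewrite le_eqVlt; apply/orP; left;
  apply/eqP; ring.
Qed.

Lemma fnorm_replace (i : 'I_N) (Y : 'I_(d i) -> 'M[R]_(r i, r i.+1)) :
  fnorm (unfolding i.+1 (tt_tensor (replace_factor X Y))) <=
  3 / 2 * weight i.+1 * fnorm (lunfold Y).
Proof.
rewrite unfolding_replace // /fnorm frob2_row_extend_orth ?gram_lface //.
exact: (@fnorm_mul_rface_near i.+1 _ _ (ltn_ord i)).
Qed.

Lemma fnorm_tt_diff :
  fnorm (unfolding 0 (tt_tensor X - tt_tensor Z)) <= 3 / 2 * \sum_i wgap i.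
Proof.
rewrite unfoldingB !unfolding_tt // -mulmxBr mul_orthomx_fnorm ?gram_lface0 //.
exact: rface_diff.
Qed.

End TwoTrains.

(** * Alignment of the factors *)

Section Alignment.
Variable R : realType.

Lemma frob2_orth_residual m n p (U : 'M[R]_(m, n)) (Y : 'M[R]_(m, p)) :
  U^T *m U = 1%:M -> frob2 (Y - U *m (U^T *m Y)) = frob2 Y - frob2 (U^T *m Y).
Proof.
move=> U1; rewrite frob2B mul_orthomx_frob2 // mxdotC mxdot_mulmxl -frob2E; ring.
Qed.

Lemma frob2_tr_orthomx_le m n p (U : 'M[R]_(m, n)) (Y : 'M[R]_(m, p)) :
  U^T *m U = 1%:M -> frob2 (U^T *m Y) <= frob2 Y.
Proof. by move=> /(frob2_orth_residual Y) h; rewrite -subr_ge0 -h frob2_ge0. Qed.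

(* Davis-Kahan: the left factor of [Us *m Vs] is close, up to a rotation, to the
   left factor of a nearby matrix [U *m V]. *)
Lemma align_orthomx m r n (U Us : 'M[R]_(m, r)) (V Vs : 'M[R]_(r, n)) (g : R) :
  U^T *m U = 1%:M -> Us^T *m Us = 1%:M -> 0 < g ->
  (forall p (W : 'M[R]_(p, r)), g ^+ 2 * frob2 W <= frob2 (W *m Vs)) ->
  frob2 (U *m V - Us *m Vs) < g ^+ 2 ->
  exists Q : 'M[R]_r, orthogonalmx Q /\
    frob2 (U - Us *m Q) <= 2 * (frob2 (U *m V - Us *m Vs) / g ^+ 2).
Proof.
move=> U1 Us1 g0 hg; set E := U *m V - Us *m Vs => Eg.
pose M := Us^T *m U; pose W := Us - U *m (U^T *m Us).
have g2 : 0 < g ^+ 2 by rewrite exprn_gt0.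
(* [W Vs] is, up to sign, the projection of [E] onto the orthogonal complement of the range of [U],
   where [U V] disappears. *)
have WE : frob2 (W *m Vs) <= frob2 E.
  have -> : W *m Vs = - (E - U *m (U^T *m E)).
    have UE : U^T *m E = V - U^T *m Us *m Vs.
      by rewrite mulmxBr !mulmxA U1 mul1mx.
    by rewrite UE mulmxBr /W mulmxBl !mulmxA opprB /E opprB [RHS]addrC addrA subrK.
  by rewrite frob2N frob2_orth_residual // gerBl frob2_ge0.
have W2 : frob2 W = r%:R - frob2 M.
  rewrite frob2_orth_residual // frob2_orthomx // -(frob2_tr M).
  by rewrite /M trmx_mul trmxK.
have rM : r%:R - frob2 M <= frob2 E / g ^+ 2.
  by rewrite -W2 ler_pdivlMr // mulrC (le_trans (hg _ _)).
have Eg1 : frob2 E / g ^+ 2 < 1 by rewrite ltr_pdivrMr // mul1r.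
have [||Q [Q1 QM]] := @procrustes R r M.
- split; first by rewrite linearB /= trmx1 trmx_mul trmxK.
  move=> x; rewrite mulmxBr mulmx1 mulmxBl mxE [X in _ + X]mxE frob2_cV subr_ge0.
  have -> : x^T *m (M^T *m M) *m x = (M *m x)^T *m (M *m x) by rewrite [(M *m
    x)^T]trmx_mul !mulmxA.
  rewrite frob2_cV /M -mulmxA; apply: le_trans (frob2_tr_orthomx_le _ Us1) _.
  by rewrite mul_orthomx_frob2.
- by move: rM Eg1 => h1 h2; lra.
exists Q; split=> //; rewrite frob2B (mul_orthomx_frob2 Q Us1) (frob2_orthomx U1)
  (frob2_orthomx Q1).
(* The squared distance is now [2 r - 2 <Q, M>], at most [2 (r - |M|^2)]: twice the sum of the
   squared sines bounded by [rM]. *)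
have -> : mxdot U (Us *m Q) = mxdot Q M by rewrite mxdotC mxdot_mulmxl.
by move: rM QM => h1 h2; lra.
Qed.

End Alignment.

(** * Bound of the aligned objective by the tensor error *)

Section Distance.
Variables (R : realType) (N : nat) (d : 'I_N -> nat) (r : nat -> nat).
Hypotheses (hN : (2 <= N)%N) (hr0 : r 0%N = 1%N) (hrN : r N = 1%N).
Variable s0 : multi_index d.
Variables X Xs : factors R d r.
Arguments X : clear implicits.
Arguments Xs : clear implicits.
Hypotheses (Xo : left_orthogonal X) (Xso : left_orthogonal Xs).
Variables g s : R.
Hypotheses (g_gt0 : 0 < g) (gs : g <= s).
Hypothesis Xsg : forall k, (0 < k < N)%N ->
  forall p (W : 'M[R]_(p, r k)), g ^+ 2 * frob2 W <= frob2 (W *m rface Xs k).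
Hypothesis Xs_ub : forall k, (0 < k < N)%N ->
  forall p (W : 'M[R]_(p, r k)), frob2 (W *m rface X k) <= (3 / 2 * s) ^+ 2 * frob2 W.

Let e2 := tnorm2 (tt_tensor X - tt_tensor Xs).
Hypothesis e2g : e2 < g ^+ 2.

Lemma align_lface k : (0 < k < N)%N ->
  exists Q : 'M[R]_(r k), orthogonalmx Q /\
    frob2 (lface X k - lface Xs k *m Q) <= 2 * (e2 / g ^+ 2).
Proof.
move=> /[dup] k0N /andP[k0 kN].
have E : e2 = frob2 (lface X k *m rface X k - lface Xs k *m rface Xs k).
  by rewrite /e2 (tnorm2_unfolding k) unfoldingB !unfolding_tt // ltnW.
rewrite E; apply: align_orthomx => //; try exact: gram_lface.
- exact: Xsg.
- by rewrite -E.
Qed.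

(** Each bond is aligned independently of the others. The identity outside [0 < k < N] meets the end
    conditions of [rotations]. *)
Definition aligning_rotations (k : nat) : 'M[R]_(r k) :=
  if (0 < k < N)%N then
    xget 1%:M [set Q | orthogonalmx Q /\
      frob2 (lface X k - lface Xs k *m Q) <= 2 * (e2 / g ^+ 2)]
  else 1%:M.

Lemma aligning_rotationsP : rotations R N r aligning_rotations.
Proof.
split=> [k|]; last by rewrite /aligning_rotations ltnn ltnn andbF.
rewrite /aligning_rotations; case: ifP => [k0N|_].
  by have [] := xgetPex 1%:M (align_lface k0N).
by rewrite /orthogonalmx trmx1 mulmx1.
Qed.

Let Z := rotate aligning_rotations Xs.
Arguments Z : clear implicits.
Let Zo : left_orthogonal Z := left_orthogonal_rotate aligning_rotationsP Xso.

(** The factor [(0 < k)%:R] records that the interfaces agree exactly at [k = 0], which spares the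
    first factor a rank term. *)
Lemma lface_aligned k : (k < N)%N ->
  frob2 (lface X k - lface Z k) <= (0 < k)%:R * (2 * (e2 / g ^+ 2)).
Proof.
move=> kN; rewrite (lface_rotate aligning_rotationsP) ?(ltnW kN) //.
case: (posnP k) => [->|k0]; last first.
  rewrite mul1r /aligning_rotations k0 kN.
  by have [] := xgetPex 1%:M (@align_lface k _); rewrite ?k0.
by rewrite /aligning_rotations /= mulmx1 subrr frob20 mul0r.
Qed.

Lemma frob2_row_extend_le (i : 'I_N) p q (P : 'M[R]_(#|row_index d i|, p))
    (Y : 'I_(d i) -> 'M[R]_(p, q)) :
  frob2 (row_extend P Y) <= frob2 P * frob2 (lunfold Y).
Proof.
rewrite -[row_extend P Y]mulmx1 -[lunfold Y]mulmx1 (frob2_row_extend s0).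
rewrite frob2_lunfold mulr_sumr; apply: ler_sum => x _; exact: frob2_mulmx.
Qed.

Let e2_ge0 : 0 <= e2.
Proof. by rewrite /e2 (tnorm2_unfolding 0) frob2_ge0. Qed.

(** The left side has the norm of the gap of factor [i], since [lface Z i] is orthonormal; the gap
    is thus controlled by the interface differences at [i] and [i.+1]. *)
Lemma row_extend_diff (i : 'I_N) :
  row_extend (lface Z i) (fun x => X i x - Z i x) =
  (lface X i.+1 - lface Z i.+1) - row_extend (lface X i - lface Z i) (X i).
Proof.
by rewrite row_extendBr row_extendBl !lfaceS opprB [RHS]addrC addrA subrK.
Qed.

(** The rank enters as [|L(X_i)|^2 = r i.+1], which multiplies the interface difference at [i]. As
    that difference is zero for [i = 0], only [r 2], ..., [r N.-1] appear in the sum. *)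
Lemma gap_aligned (i : 'I_N) : (i.+1 < N)%N ->
  gap X Z i ^+ 2 <= 4 * (e2 / g ^+ 2) * (1 + (0 < i)%:R * (r i.+1)%:R).
Proof.
move=> iN; rewrite sqr_fnorm -[lunfold _]mulmx1.
rewrite -(frob2_row_extend_orth s0 _ _ (gram_lface hr0 s0 Zo (ltn_ord i))) mulmx1.
rewrite row_extend_diff; apply: le_trans (frob2D_le _ _) _; rewrite frob2N.
have h1 := lface_aligned iN.
have h2 := le_trans (frob2_row_extend_le _ _) (ler_wpM2r (frob2_ge0 _)
  (lface_aligned (ltn_ord i))).
have := h2 _ (X i); rewrite (frob2_orthomx (Xo iN)) => {}h2.
move: h1 h2; rewrite mul1r; set a := frob2 _; set b := frob2 _ => h1 h2.
have -> : 4 * (e2 / g ^+ 2) * (1 + (0 < i)%:R * (r i.+1)%:R) =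
  2 * (2 * (e2 / g ^+ 2) + (0 < i)%:R * (2 * (e2 / g ^+ 2)) * (r i.+1)%:R) by ring.
by rewrite ler_pM2l // lerD.
Qed.

(** At the last factor the right interface is an isometry, so the first difference becomes the
    tensor error [e2] itself, and the second is seen through [rface X i], of norm at most [3/2 s].
    The constant is [2 (1 + 2 * 9/4) = 11]. *)
Lemma gap_aligned_last (i : 'I_N) : i.+1 = N ->
  gap X Z i ^+ 2 <= 11 * (s ^+ 2 / g ^+ 2) * e2.
Proof.
move=> iN; have i0 : (0 < i)%N by rewrite -ltnS iN.
have VN : rface X i.+1 *m (rface X i.+1)^T = 1%:M by rewrite iN gram_rfaceN.
have Z_eq : rface Z i.+1 = rface X i.+1 by rewrite iN !rfaceN.
have mulVN p (A : 'M[R]_(p, r i.+1)) : frob2 (A *m rface X i.+1) = frob2 A.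
  by rewrite frob2E mxdot_mulmxr -mulmxA VN mulmx1 frob2E.
rewrite sqr_fnorm -mulVN.
rewrite -(frob2_row_extend_orth s0 _ _ (gram_lface hr0 s0 Zo (ltn_ord i))).
rewrite row_extend_diff mulmxBl; apply: le_trans (frob2D_le _ _) _; rewrite frob2N.
have -> : frob2 ((lface X i.+1 - lface Z i.+1) *m rface X i.+1) = e2.
  rewrite mulmxBl -{2}Z_eq -!unfolding_tt // -unfoldingB -tnorm2_unfolding /e2.
  by rewrite (tt_tensor_rotate aligning_rotationsP).
have -> : frob2 (row_extend (lface X i - lface Z i) (X i) *m rface X i.+1) =
    frob2 ((lface X i - lface Z i) *m rface X i).
  rewrite (frob2_row_extend s0) rfaceS (frob2_col_extend s0).
  by apply: eq_bigr => x _; rewrite mulmxA.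
have i0N : (0 < i < N)%N by rewrite i0 /=.
have := le_trans (Xs_ub i0N _) (ler_wpM2l (sqr_ge0 _) (lface_aligned (ltn_ord i))).
rewrite i0 mul1r => h.
have sg1 : 1 <= s ^+ 2 / g ^+ 2.
  by rewrite ler_pdivlMr ?exprn_gt0 // mul1r ler_pXn2r ?nnegrE // ltW //
    (lt_le_trans g_gt0).
have he : e2 <= s ^+ 2 / g ^+ 2 * e2 by rewrite ler_peMl.
apply: (@le_trans _ _ (2 * (s ^+ 2 / g ^+ 2 * e2 + (3 / 2 * s) ^+ 2 * (2 * (e2 /
  g ^+ 2))))).
  by rewrite ler_pM2l // lerD.
rewrite le_eqVlt; apply/orP; left; apply/eqP.
by field; rewrite gt_eqF.
Qed.

Let tau (i : nat) : nat :=
  if i.+1 == N then 11%N else (4 * (1 + (0 < i) * r i.+1))%N.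

(** The exact total is [4 N + 7 + 4 \sum r_i], rounded up to the constant 8 of the theorem. *)
Lemma sum_tau : (\sum_(i < N) tau i <= 8 * (N + 1 + \sum_(2 <= i < N) r i))%N.
Proof.
rewrite /tau; case: N hN => [//|[//|n]] _.
rewrite big_ord_recr /= eqxx big_ord_recl /=.
have -> : (\sum_(2 <= i < n.+2) r i = \sum_(i < n) r i.+2)%N.
  by rewrite !big_add1 /= big_mkord.
rewrite (eq_bigr (fun i : 'I_n => (4 + 4 * r i.+2)%N)); last first.
  by move=> i _; rewrite /bump /= add1n !eqSS ltn_eqF // mul1n mulnDr.
rewrite big_split /= sum_nat_const card_ord -big_distrr /=.
case: (n =P 0)%N => [->|_]; lia.
Qed.

Lemma dist_aligned :
  exists Q, rotations R N r Q /\
    \sum_i wgap X (rotate Q Xs) s i ^+ 2 <=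
    8 * (N%:R + 1 + (\sum_(2 <= i < N) r i)%N%:R) * (s ^+ 2 / g ^+ 2) * e2.
Proof.
exists aligning_rotations; split; first exact: aligning_rotationsP.
have sg0 : 0 <= s ^+ 2 / g ^+ 2 * e2.
  by rewrite mulr_ge0 // divr_ge0 ?sqr_ge0.
have -> : 8 * (N%:R + 1 + (\sum_(2 <= i < N) r i)%N%:R) =
    (8 * (N + 1 + \sum_(2 <= i < N) r i))%N%:R :> R.
  by rewrite natrM !natrD.
rewrite -mulrA; apply: (@le_trans _ _ ((\sum_(i < N) tau i)%N%:R * (s ^+ 2 / g ^+
  2 * e2))).
  rewrite natr_sum mulr_suml; apply: ler_sum => i _.
  rewrite /wgap exprMn -/Z /tau /weight; case: eqP => iN.
    by rewrite expr1n mul1r mulrA gap_aligned_last.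
  have iN' : (i.+1 < N)%N by rewrite ltn_neqAle ltn_ord andbT; apply/eqP.
  apply: le_trans (ler_wpM2l (sqr_ge0 _) (gap_aligned iN')) _.
  by rewrite natrM natrD natrM le_eqVlt; apply/orP; left; apply/eqP; ring.
by rewrite ler_wpM2r // ler_nat sum_tau.
Qed.

End Distance.

(** * Decrease of the objective *)

Section StiefelProjection.
Variables (R : realType) (m n : nat).
Implicit Types L B D : 'M[R]_(m, n).

Lemma stiefel_proj_tangent L B : L^T *m L = 1%:M ->
  L^T *m stiefel_proj L B + (stiefel_proj L B)^T *m L = 0.
Proof.
move=> L1; rewrite /stiefel_proj; set S := B^T *m L + L^T *m B.
have ST : S^T = S by rewrite /S linearD /= !trmx_mul !trmxK addrC.
have e1 : L^T *m (B - 2^-1 *: (L *m S)) = L^T *m B - 2^-1 *: S.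
  by rewrite mulmxBr -scalemxAr mulmxA L1 mul1mx.
have e2 : (B - 2^-1 *: (L *m S))^T *m L = B^T *m L - 2^-1 *: S.
  have -> : (B - 2^-1 *: (L *m S))^T = B^T - 2^-1 *: (S *m L^T).
    by rewrite linearB linearZ /= trmx_mul ST.
  by rewrite mulmxBl -scalemxAl -mulmxA L1 mulmx1.
rewrite e1 e2 addrACA -opprD -scalerDl [X in X *: _](_ : _ = 1); last by lra.
by rewrite scale1r [X in X - _]addrC subrr.
Qed.

(** Since [<B, L S> = |S|^2 / 2], expanding the square leaves [|B|^2 - |S|^2 / 4]. *)
Lemma frob2_stiefel_proj L B : L^T *m L = 1%:M ->
  frob2 (stiefel_proj L B) <= frob2 B.
Proof.
move=> L1; rewrite /stiefel_proj; set S := B^T *m L + L^T *m B.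
pose W := L^T *m B; have SE : S = W^T + W by rewrite /S /W trmx_mul trmxK.
have e1 : mxdot B (L *m S) = frob2 S / 2.
  rewrite mxdotC mxdot_mulmxl -/W SE mxdotDl frob2D frob2_tr frob2E.
  by rewrite (mxdotC _ W); lra.
rewrite frob2B frob2Z mxdotZr e1 mul_orthomx_frob2 //.
by have := frob2_ge0 S; move=> h; lra.
Qed.

(* With [D = L - M], orthonormality gives [L^T D + D^T L = D^T D], so the normal
   component removed by the projection contributes at second order only. *)
Lemma mxdot_stiefel_proj L M B : L^T *m L = 1%:M -> M^T *m M = 1%:M ->
  mxdot (L - M) (stiefel_proj L B) =
  mxdot B (L - M) - 2^-1 * mxdot B (L *m ((L - M)^T *m (L - M))).
Proof.
move=> L1 M1; rewrite /stiefel_proj; set S := B^T *m L + L^T *m B.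
have ST : S^T = S by rewrite /S linearD /= !trmx_mul !trmxK addrC.
set D := L - M; pose K := D^T *m D.
have KT : K^T = K by rewrite /K trmx_mul trmxK.
have DK : L^T *m D + D^T *m L = K.
  have DT : D^T = L^T - M^T by rewrite /D linearB.
  have LD : L^T *m D = 1%:M - L^T *m M by rewrite mulmxBr L1.
  have DL : D^T *m L = 1%:M - M^T *m L by rewrite DT mulmxBl L1.
  have DM : D^T *m M = L^T *m M - 1%:M by rewrite DT mulmxBl M1.
  by rewrite LD /K {2}/D mulmxBr DL DM opprB addrC.
have e1 : mxdot D (L *m S) = mxdot (L^T *m D) S.
  by rewrite mxdotC mxdot_mulmxl mxdotC.
have e2 : mxdot D (L *m S) = mxdot (D^T *m L) S.
  by rewrite e1 -mxdot_tr ST trmx_mul trmxK.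
have e3 : 2 * mxdot D (L *m S) = mxdot K S.
  by rewrite -DK [RHS]mxdotDl -e1 -e2; ring.
have e4 : mxdot K (L^T *m B) = mxdot B (L *m K).
  by rewrite [RHS]mxdotC mxdot_mulmxl.
have e5 : mxdot K (B^T *m L) = mxdot B (L *m K).
  by rewrite -e4 -mxdot_tr KT trmx_mul trmxK.
have e6 : mxdot D (L *m S) = mxdot B (L *m K).
  by apply: (mulfI (_ : 2 != 0 :> R)) => //; rewrite e3 /S mxdotDr e4 e5; ring.
by rewrite mxdotBr mxdotZr e6 (mxdotC D).
Qed.

End StiefelProjection.

(** * One gradient step under the restricted isometry property *)

Section Descent.
Variables (R : realType) (N : nat) (d : 'I_N -> nat) (r : nat -> nat).
Hypotheses (hN : (2 <= N)%N) (hr0 : r 0%N = 1%N) (hrN : r N = 1%N).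
Variable s0 : multi_index d.
Variables (m q : nat) (A : {linear tensor R d -> 'cV[R]_m}) (delta : R).
Hypotheses (delta_ge0 : 0 <= delta) (hrip : rip A q delta).

Definition tnorm (T : tensor R d) : R := Num.sqrt (tnorm2 T).

Definition sensing_form (T T' : tensor R d) : R := m%:R^-1 * mxdot (A T) (A T').

Definition tt_ranks_le (n : nat) (T : tensor R d) : Prop :=
  forall k, (0 < k < N)%N -> (tt_rank T k <= n)%N.

Lemma tnormE k T : tnorm T = fnorm (unfolding k T).
Proof. by rewrite /tnorm (tnorm2_unfolding k). Qed.

Lemma tt_rankD (T T' : tensor R d) k :
  (tt_rank (T + T')%R k <= tt_rank T k + tt_rank T' k)%N.
Proof. by rewrite /tt_rank unfoldingD mxrank_add. Qed.

Lemma tt_rankB (T T' : tensor R d) k :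
  (tt_rank (T - T')%R k <= tt_rank T k + tt_rank T' k)%N.
Proof.
by rewrite /tt_rank unfoldingB (leq_trans (mxrank_add _ _)) // mxrank_opp.
Qed.

Lemma sensing_form_le T T' : tt_ranks_le q T -> tt_ranks_le q T' ->
  `|sensing_form T T'| <= (1 + delta) * tnorm T * tnorm T'.
Proof.
move=> /hrip[_ hT] /hrip[_ hT'].
have m0 : 0 <= m%:R^-1 :> R by rewrite invr_ge0.
rewrite /sensing_form normrM ger0_norm //.
have d1 : 0 <= 1 + delta by rewrite addr_ge0.
apply: (@le_trans _ _ (m%:R^-1 * (fnorm (A T) * fnorm (A T')))).
  by rewrite ler_wpM2l // mxdot_le.
have aux (U : tensor R d) : m%:R^-1 * frob2 (A U) <= (1 + delta) * tnorm2 U ->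
    Num.sqrt m%:R^-1 * fnorm (A U) <= Num.sqrt (1 + delta) * tnorm U.
  move=> h; rewrite /fnorm /tnorm -!sqrtrM //; exact: ler_wsqrtr.
have := ler_pM _ _ (aux _ hT) (aux _ hT').
rewrite !mulr_ge0 ?sqrtr_ge0 // => /(_ isT isT).
rewrite mulrACA -expr2 sqr_sqrtr // => /le_trans -> //.
by rewrite mulrACA -expr2 sqr_sqrtr // mulrA.
Qed.

Lemma sensing_form_ge T : tt_ranks_le q T ->
  (1 - delta) * tnorm T ^+ 2 <= sensing_form T T.
Proof.
move=> /hrip[h _]; rewrite /sensing_form -frob2E /tnorm sqr_sqrtr //.
by rewrite (tnorm2_unfolding 0) frob2_ge0.
Qed.

Lemma sensing_formDr T T1 T2 :
  sensing_form T (T1 + T2) = sensing_form T T1 + sensing_form T T2.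
Proof. by rewrite /sensing_form linearD mxdotDr mulrDr. Qed.

Lemma sensing_form_sumr T I (l : seq I) (F : I -> tensor R d) :
  sensing_form T (\sum_(i <- l) F i) = \sum_(i <- l) sensing_form T (F i).
Proof. by rewrite /sensing_form linear_sum mxdot_sumr mulr_sumr. Qed.

Hypothesis hq : forall k, (0 < k < N)%N -> (3 * r k <= q)%N.

Variables X Z : factors R d r.
Arguments X : clear implicits.
Arguments Z : clear implicits.
Hypotheses (Xo : left_orthogonal X) (Zo : left_orthogonal Z).
Variable s : R.
Hypothesis s_gt0 : 0 < s.
Hypothesis Zs : forall k, (0 < k < N)%N ->
  forall p (W : 'M[R]_(p, r k)), fnorm (W *m rface Z k) <= s * fnorm W.
Hypothesis small : \sum_i wgap X Z s i <= s / 3.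

Let E : tensor R d := tt_tensor X - tt_tensor Z.
Let e : R := tnorm E.
Let D : R := \sum_i wgap X Z s i ^+ 2.
Let F := sensing_loss A (A (tt_tensor Z)) : factors R d r -> R.
Let G (i : 'I_N) := grad_factor F X i.
Let dL (i : 'I_N) := lunfold (X i) - lunfold (Z i).
Let PG (i : 'I_N) :=
  if (i.+1 < N)%N then stiefel_proj (lunfold (X i)) (G i) else G i.

Hypothesis second_order_small : N%:R * D * e <= 8 / 15 * s * e ^+ 2.

Let e_ge0 : 0 <= e. Proof. exact: sqrtr_ge0. Qed.

Let d1 : 0 <= 1 + delta. Proof. by rewrite addr_ge0. Qed.

Lemma rank_tt (Y : factors R d r) : tt_ranks_le q (tt_tensor Y).
Proof.
move=> k /[dup] k0N /andP[k0 kN].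
apply: leq_trans (tt_rank_le hr0 hrN Y (ltnW kN)) _.
by have := hq k0N; lia.
Qed.

Lemma rank_E : tt_ranks_le q E.
Proof.
move=> k /[dup] k0N /andP[k0 kN].
have h1 := tt_rank_le hr0 hrN X (ltnW kN); have h2 := tt_rank_le hr0 hrN Z (ltnW kN).
have h3 := tt_rankB (tt_tensor X) (tt_tensor Z) k.
by have := hq k0N; rewrite /E; lia.
Qed.

(** This sum of three trains is what the factor 3 in [hq] is for. *)
Lemma rank_second_order i : tt_ranks_le q (second_order X Z i).
Proof.
move=> k /[dup] k0N /andP[k0 kN]; rewrite /second_order.
set T1 := tt_tensor _; set T2 := tt_tensor _; set T3 := tt_tensor _.
have h1 : (tt_rank T1 k <= r k)%N by exact: tt_rank_le (ltnW kN).
have h2 : (tt_rank T2 k <= r k)%N by exact: tt_rank_le (ltnW kN).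
have h3 : (tt_rank T3 k <= r k)%N by exact: tt_rank_le (ltnW kN).
have h4 := tt_rankB T1 T2 k; have h5 := tt_rankD (T1 - T2) T3 k.
by have := hq k0N; lia.
Qed.

Lemma pairing_grad (i : 'I_N) (Y : 'I_(d i) -> 'M[R]_(r i, r i.+1)) :
  mxdot (G i) (lunfold Y) = sensing_form E (tt_tensor (replace_factor X Y)).
Proof. by rewrite /G mxdot_grad_factor // /sensing_form /E linearB. Qed.

Lemma pairing_grad_le (i : 'I_N) (Y : 'I_(d i) -> 'M[R]_(r i, r i.+1)) :
  `|mxdot (G i) (lunfold Y)| <=
  (1 + delta) * e * (3 / 2 * weight N s i.+1 * fnorm (lunfold Y)).
Proof.
rewrite pairing_grad; apply: le_trans (sensing_form_le rank_E (rank_tt _)) _.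
rewrite ler_wpM2l ?mulr_ge0 // (tnormE i.+1).
exact: (fnorm_replace hr0 hrN s0 Xo Zo s_gt0 Zs small).
Qed.

(** Duality: the pairing bound is tested on the gradient itself and divided by its norm. *)
Lemma fnorm_grad (i : 'I_N) :
  fnorm (G i) <= (1 + delta) * e * (3 / 2 * weight N s i.+1).
Proof.
have w0 := weight_gt0 N s_gt0 i.+1.
have [->|G0] := eqVneq (fnorm (G i)) 0; first by rewrite !mulr_ge0 // ltW.
have Gpos : 0 < fnorm (G i) by rewrite lt_def G0 fnorm_ge0.
rewrite -(ler_pM2r Gpos) -expr2 sqr_fnorm frob2E.
have := pairing_grad_le (lfold (G i)); rewrite lunfold_lfold => h.
by apply: le_trans (le_trans (ler_norm _) h) _; rewrite !mulrA.
Qed.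

Lemma fnorm_dL i : fnorm (dL i) = gap X Z i.
Proof. by rewrite /gap -lunfoldB. Qed.

(** The projection changes the pairing by [<G, L K> / 2] with [K = dL^T dL]. As [L] is orthonormal
    and [|K| <= gap^2], the pairing bound with its [3/2] gives the coefficient [3/4]. The last
    factor is not projected. *)
Lemma regularity_term (i : 'I_N) :
  sensing_form E (tt_tensor (replace_factor X (fun x => X i x - Z i x)))
  - 3 / 4 * ((1 + delta) * e) * (wgap X Z s i ^+ 2 / s) <= mxdot (dL i) (PG i).
Proof.
have de0 : 0 <= (1 + delta) * e by rewrite mulr_ge0.
rewrite -pairing_grad -lunfoldB -/(dL i) /PG.
case: ifP => iN; last first.
  rewrite (mxdotC (G i)) lerBlDr lerDl mulr_ge0 //.
    by rewrite mulr_ge0 // divr_ge0.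
  by rewrite divr_ge0 ?sqr_ge0 // ltW.
rewrite [X in _ <= X](mxdot_stiefel_proj (G i) (Xo iN) (Zo iN)) -/(dL i) lerD2l lerN2.
set K := (dL i)^T *m dL i.
have := pairing_grad_le (lfold (lunfold (X i) *m K)); rewrite lunfold_lfold.
rewrite mul_orthomx_fnorm ?Xo // /weight ltn_eqF // => /(le_trans (ler_norm _)) h.
have K2 : fnorm K <= gap X Z i ^+ 2.
  apply: le_trans (fnorm_mulmx _ _) _; rewrite -fnorm_dL expr2.
  by rewrite {1}/fnorm frob2_tr.
have -> : wgap X Z s i ^+ 2 / s = s * gap X Z i ^+ 2.
  by rewrite /wgap /weight ltn_eqF //; field; rewrite gt_eqF.
have := ler_wpM2l (mulr_ge0 de0 (ltW s_gt0)) K2.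
by move=> h2; lra.
Qed.

Lemma gap_sum_le (i : 'I_N) :
  s * \sum_(j < N | (j < i)%N) gap X Z j = \sum_(j < N | (j < i)%N) wgap X Z s j.
Proof.
rewrite mulr_sumr; apply: eq_bigr => j ji.
by rewrite /wgap /weight ltn_eqF // (leq_ltn_trans ji).
Qed.

(** The second-order terms cost [3/2] per ordered product of gaps and the projections [3/4] per
    square, so together they form [3/4] of the full square of the sum of the gaps, at most
    [3/4 N D]. With [second_order_small] the loss is at most [3/4 * 8/15 (1 + delta) e^2 = 2/5 (1 +
    delta) e^2], to be subtracted from the gain [(1 - delta) e^2]. *)
Lemma regularity : (3 / 5 - 7 / 5 * delta) * e ^+ 2 <= \sum_i mxdot (dL i) (PG i).
Proof.
apply: le_trans (ler_sum _ (fun i _ => regularity_term i)).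
rewrite big_split /= sumrN.
have -> : \sum_i 3 / 4 * ((1 + delta) * e) * (wgap X Z s i ^+ 2 / s) =
    3 / 4 * ((1 + delta) * e) * (D / s) by rewrite -mulr_sumr -mulr_suml.
have de0 : 0 <= (1 + delta) * e by rewrite mulr_ge0.
have -> : \sum_i sensing_form E (tt_tensor (replace_factor X (fun x => X i x - Z
  i x))) =
    \sum_i sensing_form E (second_order X Z i) + sensing_form E E.
  rewrite -!sensing_form_sumr -sensing_formDr; congr sensing_form.
  by rewrite sum_second_order // subrK.
have EE := sensing_form_ge rank_E.
have ET : - (3 / 2 * ((1 + delta) * e / s) *
      \sum_i wgap X Z s i * \sum_(j < N | (j < i)%N) wgap X Z s j) <=
    \sum_i sensing_form E (second_order X Z i).
  rewrite mulr_sumr -sumrN; apply: ler_sum => i _.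
  have := sensing_form_le rank_E (rank_second_order i).
  rewrite ler_norml => /andP[+ _]; apply: le_trans; rewrite lerN2.
  have := fnorm_second_order hr0 hrN s0 Xo Zo s_gt0 Zs small i.
  rewrite -tnormE => /(ler_wpM2l de0) /le_trans; apply.
  rewrite -gap_sum_le le_eqVlt; apply/orP; left; apply/eqP.
  by field; rewrite gt_eqF.
have sq := sqr_sum_ord (wgap X Z s); have cs := sqr_sum_le (wgap X Z s).
rewrite -/D in sq cs.
set C := \sum_i _ * _ in ET sq; set W := (\sum_i wgap _ _ _ _) in sq cs.
have k0 : 0 <= (1 + delta) / s by rewrite divr_ge0 // ltW.
have h1 : (1 + delta) / s * (e * W ^+ 2) <= (1 + delta) / s * (e * (N%:R * D)).
  by rewrite ler_wpM2l // ler_wpM2l.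
have h2 : (1 + delta) / s * (e * (N%:R * D)) <= (1 + delta) * (8 / 15 * e ^+ 2).
  have -> : (1 + delta) * (8 / 15 * e ^+ 2) = (1 + delta) / s * (8 / 15 * s * e ^+ 2).
    by field; rewrite gt_eqF.
  by rewrite (mulrC e) ler_wpM2l.
have -> : 3 / 4 * ((1 + delta) * e) * (D / s) = 3 / 4 * ((1 + delta) / s * (e * D)).
  by field; rewrite gt_eqF.
have ET' : - (3 / 2 * ((1 + delta) / s * (e * C))) <= \sum_i sensing_form E
  (second_order X Z i).
  apply: le_trans ET; rewrite lerN2 le_eqVlt; apply/orP; left; apply/eqP.
  by field; rewrite gt_eqF.
have h0 : (1 + delta) / s * (e * W ^+ 2) =
    (1 + delta) / s * (e * D) + 2 * ((1 + delta) / s * (e * C)) by rewrite sq; ring.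
by move: EE ET' h0 h1 h2; rewrite -/e => EE ET' h0 h1 h2; lra.
Qed.

Variable mu : R.
Hypotheses (mu_gt0 : 0 < mu) (delta_le : delta <= 4 / 15).
Hypothesis hstep : mu <= (4 - 15 * delta) / (10 * (9 * N%:R - 5) * (1 + delta) ^+ 2).

Let X' := rgd_step F s mu X.
Arguments X' : clear implicits.

(** Dividing by the squared weight covers both step lengths, [mu / s^2] on the Stiefel factors and
    [mu] on the last one. On the former the displacement is tangent, so the retraction only brings
    the point closer to [Z]. *)
Lemma rgd_step_factor (i : 'I_N) :
  ((i.+1 < N)%N -> (lunfold (X' i))^T *m lunfold (X' i) = 1%:M) /\
  frob2 (lunfold (X' i) - lunfold (Z i)) <=
  frob2 (dL i - (mu / weight N s i.+1 ^+ 2) *: PG i).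
Proof.
rewrite /X' /rgd_step lunfold_lfold -/(G i) /PG /weight; case: ifP => iN; last first.
  split=> //; have -> : i.+1 == N by rewrite eqn_leq ltn_ord leqNgt iN.
  by rewrite expr1n divr1 /dL addrAC.
rewrite ltn_eqF //.
set xi := (mu / s ^+ 2) *: _.
have [] := @polar_retr_le R _ _ (lunfold (X i)) (- xi) (lunfold (Z i)).
- exact: Xo.
- exact: Zo.
- have := stiefel_proj_tangent (G i) (Xo iN) => tg.
  have -> : (- xi)^T = - (mu / s ^+ 2) *: (stiefel_proj (lunfold (X i)) (G i))^T.
    by rewrite linearN linearZ scaleNr.
  by rewrite /xi -scaleNr -scalemxAr -scalemxAl -scalerDr tg scaler0.
by move=> U1 le; split => [//|]; rewrite /dL [_ - _ - xi]addrAC.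
Qed.

Lemma left_orthogonal_step : left_orthogonal X'.
Proof. by move=> i iN; case: (rgd_step_factor i) => /(_ iN). Qed.

Lemma frob2_PG i : frob2 (PG i) <= frob2 (G i).
Proof. by rewrite /PG; case: ifP => iN //; rewrite frob2_stiefel_proj ?Xo. Qed.

Lemma descent :
  \sum_i wgap X' Z s i ^+ 2 <= D - mu * ((4 - 15 * delta) / 40) * e ^+ 2.
Proof.
have step (i : 'I_N) : wgap X' Z s i ^+ 2 <=
    wgap X Z s i ^+ 2 - 2 * mu * mxdot (dL i) (PG i)
    + mu ^+ 2 * (9 / 4 * (1 + delta) ^+ 2 * e ^+ 2).
  have w0 := weight_gt0 N s_gt0 i.+1; set w := weight N s i.+1 in w0 *.
  rewrite /wgap !exprMn -/w !sqr_fnorm -!lunfoldB.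
  have [_ /(ler_wpM2l (sqr_ge0 w)) /le_trans ->] // := rgd_step_factor i.
  rewrite -/(dL i) frob2B frob2Z mxdotZr -/w.
  have Gi : frob2 (PG i) <= ((1 + delta) * e * (3 / 2 * w)) ^+ 2.
    apply: le_trans (frob2_PG i) _; rewrite -fnorm_leE ?fnorm_grad //.
    by rewrite !mulr_ge0 // ltW.
  have c0 : 0 <= mu ^+ 2 / w ^+ 2 by rewrite divr_ge0 ?sqr_ge0.
  have := ler_wpM2l c0 Gi => {}Gi.
  have -> : w ^+ 2 * (frob2 (dL i) - 2 * (mu / w ^+ 2 * mxdot (dL i) (PG i)) +
      (mu / w ^+ 2) ^+ 2 * frob2 (PG i)) =
      w ^+ 2 * frob2 (dL i) - 2 * mu * mxdot (dL i) (PG i) +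
      mu ^+ 2 / w ^+ 2 * frob2 (PG i) by field; rewrite gt_eqF.
  rewrite lerD2l; apply: le_trans Gi _.
  rewrite le_eqVlt; apply/orP; left; apply/eqP; field; by rewrite gt_eqF.
apply: le_trans (ler_sum _ (fun i _ => step i)) _.
rewrite !big_split /= sumrN -mulr_sumr sumr_const card_ord -/D -mulr_natl.
have reg := ler_wpM2l (ltW mu_gt0) regularity.
have N2 : 2 <= N%:R :> R by rewrite (ler_nat R 2).
have d1_gt0 : 0 < 1 + delta by rewrite ltr_pwDl.
have N5 : 0 < 9 * N%:R - 5 :> R by lra.
have st : mu * ((9 * N%:R - 5) * (1 + delta) ^+ 2) <= (4 - 15 * delta) / 10.
  have := hstep; rewrite ler_pdivlMr ?mulr_gt0 // => h; lra.
(* [9/4 N <= 18/52 (9 N - 5)] is an equality at [N = 2], so [18/13] is the smallest factor valid for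
   all [N >= 2]. What remains of [2 (3/5 - 7/5 delta)] exceeds [(4 - 15 delta) / 40] on
   [0 <= delta <= 4/15]. *)
have st2 : mu * (N%:R * (9 / 4 * (1 + delta) ^+ 2)) <= 18 / 13 * ((4 - 15 *
  delta) / 40).
  apply: (@le_trans _ _ (18 / 13 / 4 * (mu * ((9 * N%:R - 5) * (1 + delta) ^+
    2)))); last by lra.
  have md : 0 <= mu * (1 + delta) ^+ 2 by rewrite mulr_ge0 ?sqr_ge0 // ltW.
  have : 9 / 4 * N%:R <= 18 / 13 / 4 * (9 * N%:R - 5) :> R by lra.
  by move=> /(ler_wpM2l md) h; lra.
have me0 : 0 <= mu * e ^+ 2 by rewrite mulr_ge0 ?sqr_ge0 // ltW.
have st3 := ler_wpM2l me0 st2.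
have st4 : 0 <= mu * e ^+ 2 * (4 / 15 - delta) by rewrite mulr_ge0 // subr_ge0.
have st5 : 0 <= mu * e ^+ 2 * delta by rewrite mulr_ge0.
by lra.
Qed.

End Descent.

(** * Linear convergence *)

Section LinearConvergence.
Variables (R : realType) (N : nat) (d : 'I_N -> nat) (r : nat -> nat).
Hypotheses (hN : (2 <= N)%N) (hr0 : r 0%N = 1%N) (hrN : r N = 1%N).
Variable Xs : factors R d r.
Arguments Xs : clear implicits.
Hypotheses (Xs_min : tt_minimal Xs) (Xso : left_orthogonal Xs).
Hypothesis Xs_rank : forall i, (0 < i < N)%N -> tt_rank (tt_tensor Xs) i = r i.

Let s := sigma_up (tt_tensor Xs).
Let g := sigma_low (tt_tensor Xs).

(** If [r k.+1] were 0, the right unfolding of factor [k] would have no columns, and minimality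
    would force [r k = 0]. *)
Lemma tt_rank_gt0 k : (k <= N)%N -> (0 < r k)%N.
Proof.
elim: k => [_|k IH kN]; first by rewrite hr0.
rewrite lt0n; apply/eqP => rk0.
have [_ hk] := Xs_min (Ordinal kN); have := IH (ltnW kN).
rewrite -[r k]hk /= lt0n => /eqP; apply; apply/eqP; rewrite -leqn0.
apply: leq_trans (rank_leq_col _) _.
by rewrite /= big1 // => _ _; exact: rk0.
Qed.

Let N1 : (0 < 1 < N)%N. Proof. exact: hN. Qed.

(** An unfolding of positive rank has a row and a column, and their indices merge into the base
    point required by the summation lemmas. *)
Lemma multi_index_inhabited : multi_index d.
Proof.
have h : (0 < \rank (unfolding 1 (tt_tensor Xs)))%N.
  by have := Xs_rank N1; rewrite /tt_rank => ->; rewrite tt_rank_gt0 // ltnW.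
have a : 'I_#|row_index d 1| := Ordinal (leq_trans h (rank_leq_row _)).
have b : 'I_#|col_index d 1| := Ordinal (leq_trans h (rank_leq_col _)).
exact: merge_index (enum_val a) (enum_val b).
Qed.

Let s0 : multi_index d := multi_index_inhabited.

Lemma singular_value_le_sigma_up k : (0 < k < N)%N ->
  singular_value (unfolding k (tt_tensor Xs)) 1 <= s.
Proof.
move=> k0N; apply: (le_bigmax_seq 0 k predT
  (fun i => singular_value (unfolding i (tt_tensor Xs)) 1)) => //.
by rewrite mem_index_iota.
Qed.

Lemma singular_value_rank_face k p (W : 'M[R]_(p, r k)) : (0 < k < N)%N ->
  0 < singular_value (unfolding k (tt_tensor Xs)) (r k) /\
  singular_value (unfolding k (tt_tensor Xs)) (r k) ^+ 2 * frob2 W <=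
    frob2 (W *m rface Xs k).
Proof.
move=> /[dup] k0N /andP[k0 kN]; rewrite (unfolding_tt hr0 hrN) ?(ltnW kN) //.
apply: frob2_mul_singular_value_rank; first exact: gram_lface.
  by rewrite tt_rank_gt0 // ltnW.
by rewrite -(unfolding_tt hr0 hrN) ?(ltnW kN) //; exact: Xs_rank.
Qed.

Lemma sigma_low_gt0 : 0 < g.
Proof.
have h k : (0 < k < N)%N -> 0 < singular_value (unfolding k (tt_tensor Xs))
    (tt_rank (tt_tensor Xs) k).
  by move=> k0N; rewrite Xs_rank //; case: (singular_value_rank_face (0 :
    'M[R]_(1, r k)) k0N).
rewrite /g /sigma_low big_nat_cond; apply: lt_bigmin => [|i /andP[iN _]]; exact: h.
Qed.

Lemma sigma_low_rface k p (W : 'M[R]_(p, r k)) : (0 < k < N)%N ->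
  g ^+ 2 * frob2 W <= frob2 (W *m rface Xs k).
Proof.
move=> k0N; have [s0' h] := singular_value_rank_face W k0N; apply: le_trans h.
rewrite ler_wpM2r ?frob2_ge0 // ler_pXn2r ?nnegrE ?(ltW sigma_low_gt0) ?(ltW s0') //.
rewrite -(Xs_rank k0N).
apply: (ge_bigmin_seq _ k predT
  (fun i => singular_value (unfolding i (tt_tensor Xs)) (tt_rank (tt_tensor Xs)
    i))) => //.
by rewrite mem_index_iota.
Qed.

Lemma sigma_up_ge0 : 0 <= s.
Proof. exact: bigmax_ge_id. Qed.

Lemma sigma_up_rface k p (W : 'M[R]_(p, r k)) : (0 < k < N)%N ->
  fnorm (W *m rface Xs k) <= s * fnorm W.
Proof.
move=> /[dup] k0N /andP[k0 kN]; apply: fnorm_le; first exact: sigma_up_ge0.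
have h := gram_lface hr0 s0 Xso kN.
apply: le_trans (frob2_mul_singular_value1 (rface Xs k) h W) _.
rewrite ler_wpM2r ?frob2_ge0 // -(unfolding_tt hr0 hrN) ?(ltnW kN) //.
rewrite ler_pXn2r ?nnegrE ?sigma_up_ge0 ?singular_value_le_sigma_up //.
rewrite /singular_value; set l := rev _.
have [h1|h1] := ltnP 0 (size l); first by rewrite (nth_map 0) ?sqrtr_ge0.
by rewrite nth_default // size_map.
Qed.

Lemma sigma_low_le_up : g <= s.
Proof.
have r1 : (0 < r 1)%N by rewrite tt_rank_gt0 // ltnW.
pose W : 'M[R]_(r 1) := 1%:M.
have W0 : 0 < frob2 W.
  by rewrite frob2_orthomx ?ltr0n // trmx1 mulmx1.
have := le_trans (sigma_low_rface W N1) (_ : _ <= s ^+ 2 * frob2 W).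
rewrite ler_pM2r // ler_pXn2r ?nnegrE ?sigma_up_ge0 ?(ltW sigma_low_gt0) //; apply.
by rewrite -!sqr_fnorm -exprMn ler_pXn2r ?nnegrE ?mulr_ge0 ?fnorm_ge0
  ?sigma_up_ge0 // sigma_up_rface.
Qed.

Let s_gt0 : 0 < s. Proof. exact: lt_le_trans sigma_low_gt0 sigma_low_le_up. Qed.

Lemma tt_tensor_neq0 : 0 < tnorm2 (tt_tensor Xs).
Proof.
rewrite lt_def (tnorm2_unfolding 1) frob2_ge0 andbT; apply/eqP => /frob2_eq0 h.
have := Xs_rank N1; rewrite /tt_rank h mxrank0 => r1.
by have := @tt_rank_gt0 1 (ltnW hN); rewrite -r1.
Qed.

Lemma dist2_rotations (X : factors R d r) :
  dist2 X Xs = inf [set \sum_i wgap X (rotate Q Xs) s i ^+ 2 | Q in rotations R N r].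
Proof.
rewrite /dist2; congr inf; apply: eq_imagel => Q _.
rewrite [RHS](bigID (fun i : 'I_N => (i.+1 < N)%N)) /=; congr (_ + _).
  apply: eq_bigr => i iN; rewrite /wgap exprMn /weight ltn_eqF //.
  by rewrite sqr_fnorm -lunfoldB.
have E (i : 'I_N) : (i.+1 == N) = ~~ (i.+1 < N)%N.
  by rewrite -leqNgt eqn_leq ltn_ord.
apply: eq_big => [i|i iN]; first exact: E.
by rewrite /wgap exprMn /weight iN expr1n mul1r sqr_fnorm -lunfoldB.
Qed.

Let obj (X : factors R d r) Q := \sum_i wgap X (rotate Q Xs) s i ^+ 2.

Lemma obj_ge0 X Q : 0 <= obj X Q.
Proof. by apply: sumr_ge0 => i _; exact: sqr_ge0. Qed.

Lemma has_lbound_obj X : has_lbound [set obj X Q | Q in rotations R N r].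
Proof. by exists 0 => _ [Q _ <-]; exact: obj_ge0. Qed.

Lemma dist2_le X Q : rotations R N r Q -> dist2 X Xs <= obj X Q.
Proof.
by move=> hQ; rewrite dist2_rotations; apply: ge_inf;
  [exact: has_lbound_obj | exists Q].
Qed.

(** Near-minimisers stand in for a minimiser, so no compactness argument on the rotations is
    made. *)
Lemma dist2_approx X eps : 0 < eps ->
  exists Q, rotations R N r Q /\ obj X Q < dist2 X Xs + eps.
Proof.
move=> eps0; rewrite dist2_rotations.
have [|_ [Q hQ <-] h] := @inf_adherent _ [set obj X Q | Q in rotations R N r] _ eps0.
  split; last exact: has_lbound_obj.
  exists (obj X (fun k => 1%:M)); exists (fun k => 1%:M) => //.
  by split=> // k; rewrite /orthogonalmx trmx1 mulmx1.
by exists Q.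
Qed.

Lemma dist2_ge0 X : 0 <= dist2 X Xs.
Proof.
apply/ler_addgt0Pr => eps eps0; have [Q [_ h]] := dist2_approx X eps0.
exact: le_trans (obj_ge0 X Q) (ltW h).
Qed.

Lemma sigma_up_rface_rotate Q : rotations R N r Q -> forall k, (0 < k < N)%N ->
  forall p (W : 'M[R]_(p, r k)), fnorm (W *m rface (rotate Q Xs) k) <= s * fnorm W.
Proof.
move=> hQ k /[dup] k0N /andP[k0 kN] p W; rewrite (rface_rotate hQ) ?(ltnW kN) //.
rewrite mulmxA; apply: le_trans (sigma_up_rface _ k0N) _.
rewrite ler_wpM2l ?sigma_up_ge0 // -/(fnorm _) /fnorm.
by rewrite frob2E mxdot_mulmxr trmxK -mulmxA (rotation_orth hQ) mulmx1 -frob2E.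
Qed.

Lemma wgap_sum_small X Q : obj X Q * N%:R <= (g / 3) ^+ 2 ->
  \sum_i wgap X (rotate Q Xs) s i <= g / 3.
Proof.
move=> h; have g3 : 0 <= g / 3 by rewrite divr_ge0 // ltW // sigma_low_gt0.
rewrite -(@ler_pXn2r _ 2%N) ?nnegrE //.
  by apply: le_trans (sqr_sum_le _) _; rewrite mulrC.
by apply: sumr_ge0 => i _; apply: wgap_ge0.
Qed.

Variables (m : nat) (A : {linear tensor R d -> 'cV[R]_m}) (delta : R).
Hypothesis delta_le : delta <= 4 / 15.
Hypothesis hrip : rip A ((N + 3) * \max_(1 <= i < N) r i)%N delta.
Variable mu : R.
Hypothesis mu_gt0 : 0 < mu.
Hypothesis hstep :
  mu <= (4 - 15 * delta) / (10 * (9 * N%:R - 5) * (1 + delta) ^+ 2).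

Lemma rank_bound k : (0 < k < N)%N ->
  (3 * r k <= (N + 3) * \max_(1 <= i < N) r i)%N.
Proof.
move=> k0N; apply: leq_mul; first by rewrite leq_addl.
by apply: (bigmaxn_sup_seq k) => //; rewrite mem_index_iota.
Qed.

(** The isometry property at the nonzero tensor [[Xs]] forces [1 - delta <= 1 + delta]. *)
Lemma delta_ge0 : 0 <= delta.
Proof.
have [|h1 h2] := hrip (X := tt_tensor Xs).
  move=> k k0N; rewrite Xs_rank //; apply: leq_trans (rank_bound k0N).
  by rewrite leq_pmull.
have := le_trans h1 h2; rewrite ler_pM2r ?tt_tensor_neq0 //; lra.
Qed.

Let S : R := N%:R + 1 + (\sum_(2 <= i < N) r i)%N%:R.
Let q : R := 57 * N%:R ^+ 2 + 393 * N%:R - 450.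
Let P : R := 4 - 15 * delta.
Let bound : R := P * g ^+ 2 / (8 * S * q).

Let N2 : 2 <= N%:R :> R. Proof. by rewrite (ler_nat R 2). Qed.

Let S_ge : N%:R + 1 <= S.
Proof. by rewrite /S lerDl ler0n. Qed.

Let q_ge : 57 * N%:R ^+ 2 <= q.
Proof. by rewrite /q; move: N2 => ?; lra. Qed.

Let N2_gt0 : 0 < N%:R ^+ 2 :> R.
Proof. by rewrite exprn_gt0 // (lt_le_trans _ N2). Qed.

Let q_gt0 : 0 < q.
Proof. by apply: lt_le_trans q_ge; rewrite mulr_gt0. Qed.

Let S_gt0 : 0 < S.
Proof. by apply: lt_le_trans S_ge; move: N2 => ?; lra. Qed.

(** Equality [delta = 4/15] is ruled out by [0 < mu] together with the step size bound. *)
Let P_gt0 : 0 < P.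
Proof.
have c0 : 0 < 10 * (9 * N%:R - 5) * (1 + delta) ^+ 2.
  have := delta_ge0 => d0; have d1 : 0 < (1 + delta) ^+ 2.
    by rewrite exprn_gt0 // ltr_pwDl.
  by rewrite mulr_gt0 // mulr_gt0 //; move: N2 => ?; lra.
by have := lt_le_trans mu_gt0 hstep; rewrite pmulr_lgt0 // invr_gt0.
Qed.

Let bound_gt0 : 0 < bound.
Proof. by rewrite divr_gt0 ?mulr_gt0 ?sigma_low_gt0. Qed.

(** The factor 2 leaves room for rotations whose objective exceeds the distance by up to [bound];
    with Cauchy-Schwarz over the [N] factors it keeps the sum of the gaps below [g / 3]. *)
Let bound_small : 2 * bound * N%:R <= (g / 3) ^+ 2.
Proof.
have P4 : P <= 4 by have := delta_ge0 => ?; rewrite /P; lra.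
have c0 : 0 < 8 * S * q by rewrite !mulr_gt0.
have g2 : 0 <= g ^+ 2 by rewrite sqr_ge0.
have -> : 2 * bound * N%:R = 2 * P * N%:R * g ^+ 2 / (8 * S * q) by rewrite
  /bound; ring.
rewrite ler_pdivrMr //.
have h1 : 8 * 3 * (57 * N%:R ^+ 2) <= 8 * S * q.
  have S3 : 8 * 3 <= 8 * S by move: S_ge N2 => ? ?; lra.
  by apply: ler_pM => //; apply: mulr_ge0 => //; exact: ltW.
have h2 : N%:R <= N%:R ^+ 2 :> R by rewrite expr2 ler_peMl // (le_trans _ N2) ?ler1n.
have h3 : 2 * P * N%:R <= 8 * N%:R ^+ 2.
  have : P * N%:R <= 4 * N%:R ^+ 2 by exact: ler_pM (ltW P_gt0) (ler0n _ _) P4 h2.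
  by move=> ?; lra.
have h4 : 2 * P * N%:R <= 9^-1 * (8 * S * q) by move: h1 h3 N2_gt0 => ? ? ?; lra.
have := ler_wpM2l g2 h4 => h5; rewrite exprMn exprVn; lra.
Qed.

Lemma one_step X : left_orthogonal X -> dist2 X Xs <= bound ->
  let X' := rgd_step (sensing_loss A (A (tt_tensor Xs))) s mu X in
  left_orthogonal X' /\
  dist2 X' Xs <= (1 - P / (320 * S * cond_number (tt_tensor Xs) ^+ 2) * mu) *
    dist2 X Xs.
Proof.
move=> Xo hX X'; pose e := tnorm (tt_tensor X - tt_tensor Xs).
have e0 : 0 <= e by exact: sqrtr_ge0.
have e2E : e ^+ 2 = tnorm2 (tt_tensor X - tt_tensor Xs).
  by rewrite /e sqr_sqrtr // (tnorm2_unfolding 0) frob2_ge0.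
have smallQ Q : obj X Q <= 2 * bound -> \sum_i wgap X (rotate Q Xs) s i <= g / 3.
  move=> h; apply: wgap_sum_small; apply: le_trans bound_small.
  by rewrite ler_wpM2r.
have gs3 : g / 3 <= s / 3 by rewrite ler_pM2r ?sigma_low_le_up.
have rotE Q (hQ : rotations R N r Q) := tt_tensor_rotate hQ Xs hr0 hrN.
have X'o : left_orthogonal X'.
  exact: (left_orthogonal_step A Xo Xso s mu).
split=> //.
(* A coarse near-minimiser, chosen before the slack, provides the a priori facts that alignment
   requires: [e <= g / 2] and the [3/2 s] bound on the right interfaces of [X]. *)
have [Q0 [hQ0 dQ0]] := dist2_approx X bound_gt0.
have smallQ0 : \sum_i wgap X (rotate Q0 Xs) s i <= g / 3.
  by apply: smallQ; move: (ltW dQ0) hX => h1 h2; lra.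
have Z0o := left_orthogonal_rotate hQ0 Xso.
have Z0s := sigma_up_rface_rotate hQ0.
have eg : e <= g / 2.
  rewrite /e (tnormE 0) -(rotE Q0 hQ0).
  apply: le_trans (fnorm_tt_diff hr0 hrN s0 Z0o s_gt0 Z0s (le_trans smallQ0 gs3)) _.
  by move: smallQ0 => ?; lra.
have dist_le : dist2 X Xs <= 8 * S * (s ^+ 2 / g ^+ 2) * e ^+ 2.
  have [||Q [hQ h]] := dist_aligned hN hr0 hrN s0 Xo Xso sigma_low_gt0
    sigma_low_le_up (fun k k0N p W => sigma_low_rface W k0N).
  - move=> k k0N p W; rewrite -!sqr_fnorm -exprMn.
    rewrite ler_pXn2r ?nnegrE ?mulr_ge0 ?fnorm_ge0 ?(ltW s_gt0) //.
    have kN : (0 < k <= N)%N by case/andP: k0N => -> /ltnW ->.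
    have := fnorm_mul_rface_near hrN s0 Z0o s_gt0 Z0s (le_trans smallQ0 gs3) W kN.
    by rewrite /weight ltn_eqF //; case/andP: k0N.
  - rewrite -e2E ltr_pXn2r ?nnegrE ?(ltW sigma_low_gt0) //.
    by move: eg sigma_low_gt0 => ? ?; lra.
  by rewrite e2E; apply: le_trans (dist2_le X hQ) h.
set kap := s ^+ 2 / g ^+ 2 in dist_le.
have kap_gt0 : 0 < kap by rewrite divr_gt0 // exprn_gt0 ?sigma_low_gt0.
have condE : cond_number (tt_tensor Xs) ^+ 2 = kap by rewrite /cond_number expr_div_n.
(* The constant 320 is 8 from the alignment bound times 40 from the decrease. *)
have rate : P / (320 * S * cond_number (tt_tensor Xs) ^+ 2) * dist2 X Xs <= P /
  40 * e ^+ 2.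
  have c0 : 0 < P / (320 * S * kap).
    exact: (divr_gt0 P_gt0 (mulr_gt0 (mulr_gt0 (ltr0Sn _ _) S_gt0) kap_gt0)).
  rewrite condE; move/ltW in c0.
  apply: le_trans (ler_wpM2l c0 dist_le) _.
  rewrite le_eqVlt; apply/orP; left; apply/eqP.
  by field; rewrite !gt_eqF.
suff main : dist2 X' Xs <= dist2 X Xs - mu * (P / 40) * e ^+ 2.
  apply: le_trans main _; have := ler_wpM2l (ltW mu_gt0) rate => h; lra.
apply/ler_addgt0Pr => eps eps0.
(* With this slack the objective is at most twice the alignment bound. For [e = 0] that bound is 0
   and cannot serve as a slack, but then [second] is trivial. *)
pose e3 := if e == 0 then eps else 8 * S * kap * e ^+ 2.
have e3_gt0 : 0 < e3.
  rewrite /e3; case: eqP => // /eqP e_neq0.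
  have e_gt0 : 0 < e by rewrite lt_def e_neq0.
  exact: (mulr_gt0 (mulr_gt0 (mulr_gt0 (ltr0Sn _ _) S_gt0) kap_gt0) (exprn_gt0 2
    e_gt0)).
pose eta := Num.min eps (Num.min bound e3).
have eta_gt0 : 0 < eta by rewrite !lt_min eps0 bound_gt0 e3_gt0.
have [Q [hQ dQ]] := dist2_approx X eta_gt0.
have eta_eps : eta <= eps by rewrite ge_min lexx.
have eta_bound : eta <= bound by rewrite !ge_min lexx orbT.
have eta_e3 : eta <= e3 by rewrite !ge_min lexx !orbT.
have dQb : obj X Q <= 2 * bound by move: (ltW dQ) hX eta_bound => ? ? ?; lra.
have Zo := left_orthogonal_rotate hQ Xso.
have Zs := sigma_up_rface_rotate hQ.
have sml := le_trans (smallQ Q dQb) gs3.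
have rot := rotE Q hQ.
have second : N%:R * obj X Q * e <= 8 / 15 * s * e ^+ 2.
  have [e_eq0|e_neq0] := eqVneq e 0; first by rewrite e_eq0 mulr0 expr0n mulr0.
  have e_gt0 : 0 < e by rewrite lt_def e_neq0.
  rewrite expr2 mulrA ler_pM2r //.
  have lhs0 : 0 <= N%:R * obj X Q by rewrite mulr_ge0 ?obj_ge0.
  have rhs0 : 0 <= 8 / 15 * s * e.
    by rewrite mulr_ge0 // mulr_ge0 ?divr_ge0 // ltW.
  rewrite -(@ler_pXn2r _ 2%N) ?nnegrE //.
  have dQe : obj X Q <= 16 * S * kap * e ^+ 2.
    move: eta_e3; rewrite /e3 (negPf e_neq0) => h;
      move: (ltW dQ) dist_le h => ? ? ?; lra.
  (* The square of the objective is bounded by the product of its two bounds, in which [S] and [g]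
     cancel. The constant 57 in [q] then gives [16/57], just below [(8/15)^2 = 64/225]. *)
  have sq : obj X Q ^+ 2 <= 2 * bound * (16 * S * kap * e ^+ 2).
    by rewrite expr2 ler_pM ?obj_ge0.
  have sqE : 2 * bound * (16 * S * kap * e ^+ 2) = 4 * P / q * (s * e) ^+ 2.
    rewrite /bound /kap; field; rewrite !gt_eqF ?sigma_low_gt0 //.
  rewrite sqE in sq.
  have Pq : N%:R ^+ 2 * (4 * P / q) <= 16 / 57.
    rewrite mulrA ler_pdivrMr //.
    have P4 : P <= 4 by have := delta_ge0 => ?; rewrite /P; lra.
    have := ler_wpM2l (ltW N2_gt0) P4; move: q_ge => ? ?; lra.
  have se2 : 0 <= (s * e) ^+ 2 by rewrite sqr_ge0.
  have h1 := ler_wpM2l (ltW N2_gt0) sq.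
  have h2 := ler_wpM2r se2 Pq.
  by rewrite exprMn; move: h1 h2 se2; rewrite !exprMn => h1 h2 se2; lra.
have := descent hN hr0 hrN s0 delta_ge0 hrip rank_bound Xo Zo s_gt0 Zs sml.
(* [descent] is stated for measurements of the rotated train; rotations do not change its tensor. *)
rewrite !rot -/e => /(_ second mu mu_gt0 delta_le hstep) => desc.
apply: le_trans (dist2_le X' hQ) _.
apply: le_trans (desc) _.
by move: (ltW dQ) eta_eps => h1 h2; rewrite -/P -/(obj X Q); lra.
Qed.

End LinearConvergence.

Theorem theorem7 (R : realType) (N : nat) (hN : (2 <= N)%N)
  (d : 'I_N -> nat) (r : nat -> nat) (hr0 : r 0%N = 1%N) (hrN : r N = 1%N)
  (Xstar : tensor R d)
  (hXstar_rank : forall i, (0 < i < N)%N -> tt_rank Xstar i = r i)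
  (Xs : factors R d r) (hXs : Xstar = tt_tensor Xs)
  (hXs_min : tt_minimal Xs) (hXs_orth : left_orthogonal Xs)
  (m : nat) (A : {linear tensor R d -> 'cV[R]_m})
  (delta : R) (hdelta : delta <= 4 / 15)
  (hrip : rip A ((N + 3) * \max_(1 <= i < N) r i)%N delta)
  (y : 'cV[R]_m) (hy : y = A Xstar)
  (mu : R) (hmu : 0 < mu)
  (X0 : factors R d r) (hX0 : left_orthogonal X0)
  (hinit : dist2 X0 Xs <=
     (4 - 15 * delta) * sigma_low Xstar ^+ 2 /
     (8 * (N%:R + 1 + (\sum_(2 <= i < N) r i)%N%:R) *
      (57 * N%:R ^+ 2 + 393 * N%:R - 450)))
  (hstep : mu <=
     (4 - 15 * delta) / (10 * (9 * N%:R - 5) * (1 + delta) ^+ 2)) :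
  let X := rgd (sensing_loss A y) (sigma_up Xstar) mu X0 in
  forall t : nat,
    dist2 (X t.+1) Xs <=
    (1 - (4 - 15 * delta) /
         (320 * (N%:R + 1 + (\sum_(2 <= i < N) r i)%N%:R) *
          cond_number Xstar ^+ 2) * mu) *
    dist2 (X t) Xs.
Proof.
move=> X; subst y; subst Xstar.
have step Y := @one_step R N d r hN hr0 hrN Xs hXs_min hXs_orth hXstar_rank
  m A delta hdelta hrip mu hmu hstep Y.
set b := (X in _ <= X) in hinit; set c := (X in 1 - X * mu).
have P0 : 0 <= 4 - 15 * delta by lra.
have S0 : 0 <= N%:R + 1 + (\sum_(2 <= i < N) r i)%N%:R :> R by rewrite !addr_ge0.
have c0 : 0 <= c := divr_ge0 P0 (mulr_ge0 (mulr_ge0 (ler0n _ _) S0) (sqr_ge0 _)).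
have cmu0 : 0 <= c * mu := mulr_ge0 c0 (ltW hmu).
(* A step contracts only from inside the basin; as the factor is at most 1 and distances are
   nonnegative, the basin is preserved along with left orthogonality. *)
have inv t : left_orthogonal (X t) /\ dist2 (X t) Xs <= b.
  elim: t => [//|t [Xo Xb]]; have [X'o X'b] := step _ Xo Xb.
  split=> //; apply: le_trans X'b _; apply: le_trans Xb.
  by apply: ler_piMl; [exact: dist2_ge0 | rewrite gerBl].
by move=> t; have [Xo Xb] := inv t; have [_] := step _ Xo Xb.
Qed.
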